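(* Let $\mathfrak g$ be of type $E_6$ and let $\lambda\in P^+$ be such that $\lambda(h_3)=0$ and $\{2,4\}\nsubseteq\mathrm{supp}(\lambda)$. Then either $\Psi^\lambda=\emptyset$ or there exists $\nu\in P$ such that $\Psi^\lambda=\Psi_\nu$.
   Context: $\mathfrak g$ is the simple complex Lie algebra of type $E_6$, with Dynkin diagram nodes $I=\{1,\dots,6\}$ labelled so that $1-2-3-4-5$ is a chain and $6$ is joined to $3$. $\mathfrak h$ is a Cartan subalgebra, $R^+$ the positive roots, $\alpha_i$ simple roots, $h_i$ co-roots, $\omega_i$ fundamental weights, $P$ the weight lattice, $P^+$ the dominant weights, $\mathfrak n^\pm$ the sums of positive/negative root spaces, $x_\alpha^\pm$ a generator of the root space $\mathfrak g_{\pm\alpha}$; $\mathrm{supp}(\lambda)=\{i\in I:\lambda(h_i)\ne0\}$. $\mathfrak g[t]=\mathfrak g\otimes\mathbb C[t]$, $x_{\alpha,r}^-=x_\alpha^-\otimes t^r$, and $x\in\mathfrak g$ is identified with $x\otimes1$. For $i\in I$, $m\in\mathbb Z_{\ge0}$, $M(m\omega_i)$ is the quotient of $U(\mathfrak g[t])$ by the left ideal generated by $\mathfrak n^+[t]$, $\mathfrak h\otimes t\mathbb C[t]$, $h_j$ and $x_{\alpha_j}^-$ ($j\ne i$), $h_i-m$, $(x_{\alpha_i}^-)^{m+1}$, $x_{\alpha_i,1}^-$; $v_{i,m}$ is the image of $1$; $R(i,m,r)=\{\alpha\in R^+:x_{\alpha,r}^-v_{i,m}=0\}$ for $r\in\mathbb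 Z_{\ge0}$; $R(\lambda,r)=\bigcap_{i\in I}R(i,\lambda(h_i),r)$. For $\lambda\in P^+$ with $R(\lambda,2)=R^+$ (which holds when $\lambda(h_3)=0$), $\Psi^\lambda=R^+\setminus R(\lambda,1)$. For $\nu\in P$, $$\Psi_\nu=\{\alpha\in R^+:(\alpha,\nu)=\max\{(\beta,\nu):\beta\in R^+\}\},$$ where $(\cdot,\cdot)$ is the bilinear form on $P\times P$ induced from the Killing form of $\mathfrak g$. *)

(* Defs.v *)
From HB Require Import structures.
From mathcomp Require Import all_boot all_order all_algebra.
From mathcomp Require Import generic_quotient boolp classical_sets reals.
From mathcomp.real_closed Require Import complex.
Set Implicit Arguments.
Unset Strict Implicit.
Unset Printing Implicit Defensive.
Import Order.TTheory GRing.Theory Num.Theory.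
Local Open Scope ring_scope.

(** * Lie algebras *)

HB.mixin Record Lmodule_isLie (K : fieldType) (L : Type)
    of GRing.Lmodule K L := {
  lie : L -> L -> L;
  lie_linearl : forall (a : K) (x y z : L),
    lie (a *: x + y) z = a *: lie x z + lie y z;
  lie_linearr : forall (a : K) (x y z : L),
    lie x (a *: y + z) = a *: lie x y + lie x z;
  liexx : forall x : L, lie x x = 0;
  lie_jacobi : forall x y z : L,
    lie x (lie y z) + lie y (lie z x) + lie z (lie x y) = 0
}.

#[short(type="lieAlgType")]
HB.structure Definition LieAlg (K : fieldType) :=
  { L of Lmodule_isLie K L & GRing.Lmodule K L }.

#[short(type="finLieAlgType")]
HB.structure Definition FinLieAlg (K : fieldType) :=
  { L of LieAlg K L & Vector K L }.

Section LieTheory.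
Variables (K : fieldType) (L : lieAlgType K).
Implicit Types x y z : L.

Lemma lieDl x y z : lie (x + y) z = lie x z + lie y z.
Proof. by have := lie_linearl 1 x y z; rewrite !scale1r. Qed.

Lemma lieDr x y z : lie x (y + z) = lie x y + lie x z.
Proof. by have := lie_linearr 1 x y z; rewrite !scale1r. Qed.

Lemma lie0l y : lie 0 y = 0.
Proof. by apply: (@addrI _ (lie 0 y)); rewrite -lieDl !addr0. Qed.

Lemma lie0r y : lie y 0 = 0.
Proof. by apply: (@addrI _ (lie y 0)); rewrite -lieDr !addr0. Qed.

Lemma lieZl a x y : lie (a *: x) y = a *: lie x y.
Proof. by have := lie_linearl a x 0 y; rewrite lie0l !addr0. Qed.

Lemma lieZr a x y : lie x (a *: y) = a *: lie x y.
Proof. by have := lie_linearr a x y 0; rewrite lie0r !addr0. Qed.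

Lemma lieC x y : lie x y = - lie y x.
Proof.
apply/eqP; rewrite -addr_eq0; apply/eqP.
have := liexx (x + y).
by rewrite lieDl !lieDr !liexx addr0 add0r.
Qed.

Lemma lie_suml (I : Type) (r : seq I) (P : pred I) (F : I -> L) y :
  lie (\sum_(i <- r | P i) F i) y = \sum_(i <- r | P i) lie (F i) y.
Proof.
exact: (big_morph (fun x => lie x y) (fun a b => lieDl a b y) (lie0l y)).
Qed.

Lemma lie_sumr (I : Type) (r : seq I) (P : pred I) (F : I -> L) x :
  lie x (\sum_(i <- r | P i) F i) = \sum_(i <- r | P i) lie x (F i).
Proof. exact: (big_morph (lie x) (lieDr x) (lie0r x)). Qed.

End LieTheory.

Definition simple_lie (K : fieldType) (g : finLieAlgType K) : Prop :=
  (exists x y : g, lie x y != 0) /\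
  (forall I : {vspace g},
     (forall x y : g, y \in I -> lie x y \in I) -> I = 0%VS \/ I = fullv).

(* The Killing form: the trace of [ad x \o ad y], computed in a basis. *)
Definition killing (K : fieldType) (g : finLieAlgType K) (x y : g) : K :=
  \sum_(i < \dim {:g})
     coord (vbasis {:g}) i (lie x (lie y (vbasis {:g})`_i)).

(** * The current algebra g[t]

    An element [\sum_r x_r t^r] is given by its finitely supported family of
    coefficients [r |-> x_r]. *)

Section Current.
Variables (K : fieldType) (g : lieAlgType K).

Record current := Current {
  ccoef :> nat -> g;
  ccoef_fin : exists N : nat, forall n : nat, (N <= n)%N -> ccoef n = 0
}.

HB.instance Definition _ := gen_eqMixin current.
HB.instance Definition _ := gen_choiceMixin current.

Lemma currentP (u v : current) : (forall n, u n = v n) -> u = v.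
Proof.
case: u v => [u hu] [v hv] /= /funext uv; subst v.
by congr Current; exact: Prop_irrelevance.
Qed.

Fact czero_fin :
  exists N : nat, forall n : nat, (N <= n)%N -> (fun=> 0 : g) n = 0.
Proof. by exists 0%N. Qed.
Definition czero := Current czero_fin.

Fact copp_fin (u : current) :
  exists N : nat, forall n : nat, (N <= n)%N -> - u n = 0.
Proof.
by case: (ccoef_fin u) => N uN; exists N => n /uN ->; rewrite oppr0.
Qed.
Definition copp u := Current (copp_fin u).

Fact cadd_fin (u v : current) :
  exists N : nat, forall n : nat, (N <= n)%N -> u n + v n = 0.
Proof.
case: (ccoef_fin u) (ccoef_fin v) => [N uN] [M vM].
by exists (maxn N M) => n; rewrite geq_max => /andP[/uN-> /vM->]; rewrite addr0.
Qed.
Definition cadd u v := Current (cadd_fin u v).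

Fact cscale_fin (a : K) (u : current) :
  exists N : nat, forall n : nat, (N <= n)%N -> a *: u n = 0.
Proof.
by case: (ccoef_fin u) => N uN; exists N => n /uN ->; rewrite scaler0.
Qed.
Definition cscale a u := Current (cscale_fin a u).

Fact caddA : associative cadd.
Proof. by move=> u v w; apply: currentP => n /=; rewrite addrA. Qed.
Fact caddC : commutative cadd.
Proof. by move=> u v; apply: currentP => n /=; rewrite addrC. Qed.
Fact cadd0 : left_id czero cadd.
Proof. by move=> u; apply: currentP => n /=; rewrite add0r. Qed.
Fact caddN : left_inverse czero copp cadd.
Proof. by move=> u; apply: currentP => n /=; rewrite addNr. Qed.

HB.instance Definition _ := GRing.isZmodule.Build current caddA caddC cadd0 caddN.

Fact cscaleA a b (u : current) : cscale a (cscale b u) = cscale (a * b) u.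
Proof. by apply: currentP => n /=; rewrite scalerA. Qed.
Fact cscale1 : left_id 1 cscale.
Proof. by move=> u; apply: currentP => n /=; rewrite scale1r. Qed.
Fact cscaleDr : right_distributive cscale +%R.
Proof. by move=> a u v; apply: currentP => n /=; rewrite scalerDr. Qed.
Fact cscaleDl (u : current) : {morph cscale^~ u : a b / a + b}.
Proof. by move=> a b; apply: currentP => n /=; rewrite scalerDl. Qed.

HB.instance Definition _ := GRing.Zmodule_isLmodule.Build K current
  cscaleA cscale1 cscaleDr cscaleDl.

Lemma ccoefD (u v : current) n : (u + v) n = u n + v n. Proof. by []. Qed.
Lemma ccoefZ a (u : current) n : (a *: u) n = a *: u n. Proof. by []. Qed.
Lemma ccoef0 n : (0 : current) n = 0. Proof. by []. Qed.

Fact clie_fin (u v : current) :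
  exists N : nat, forall n : nat, (N <= n)%N ->
    \sum_(i < n.+1) lie (u i) (v (n - i)%N) = 0.
Proof.
case: (ccoef_fin u) (ccoef_fin v) => [N uN] [M vM].
exists (N + M)%N => n NMn; apply: big1 => i _.
case: (leqP N i) => [/uN->|iN]; first by rewrite lie0l.
have lein : (i <= n)%N by rewrite -ltnS.
rewrite vM ?lie0r // leq_subRL //.
by apply: leq_trans NMn; rewrite leq_add2r ltnW.
Qed.

(* [x t^r, y t^s] = [x, y] t^(r + s), extended bilinearly. *)
Definition clie (u v : current) : current := Current (clie_fin u v).

Lemma clieE (u v : current) n :
  clie u v n =
  \sum_(i < n.+1) \sum_(j < n.+1 | (i + j == n)%N) lie (u i) (v j).
Proof.
apply: eq_bigr => i _.
have lin : (n - i < n.+1)%N by rewrite ltnS leq_subr.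
rewrite (big_pred1 (Ordinal lin)) // => j /=.
by rewrite -val_eqE /= -[RHS](eqn_add2l i) subnKC // -ltnS.
Qed.

Fact clie_linearl a (x y z : current) :
  clie (a *: x + y) z = a *: clie x z + clie y z.
Proof.
apply: currentP => n /=; rewrite scaler_sumr -big_split /=.
by apply: eq_bigr => i _; rewrite lie_linearl.
Qed.

Fact clie_linearr a (x y z : current) :
  clie x (a *: y + z) = a *: clie x y + clie x z.
Proof.
apply: currentP => n /=; rewrite scaler_sumr -big_split /=.
by apply: eq_bigr => i _; rewrite lie_linearr.
Qed.

Fact cliexx (x : current) : clie x x = 0.
Proof.
apply: currentP => n; rewrite clieE ccoef0.
under eq_bigr do rewrite big_mkcond /=.
rewrite pair_big /= (bigID (fun p : 'I_n.+1 * 'I_n.+1 => (p.1 < p.2)%N)) /=.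
rewrite [X in _ + X](bigID (fun p : 'I_n.+1 * 'I_n.+1 => p.1 == p.2)) /=.
rewrite [X in _ + (X + _)]big1 => [|[i j] /= /andP[_ /eqP->]]; last first.
  by rewrite liexx if_same.
rewrite add0r.
rewrite [X in _ + X](reindex (fun p : 'I_n.+1 * 'I_n.+1 => (p.2, p.1))) /=;
  last by exists (fun p : 'I_n.+1 * 'I_n.+1 => (p.2, p.1)) => -[].
under [X in _ + X]eq_bigl => p do
  rewrite -leqNgt -val_eqE /= [X in ~~ X]eq_sym andbC -ltn_neqAle.
rewrite -big_split /= big1 // => -[i j] _ /=.
by rewrite [(j + i)%N]addnC; case: eqP => _; rewrite ?addr0 // [lie (x j) _]lieC subrr.
Qed.

Lemma clie3E (x y z : current) n :
  clie x (clie y z) n =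
  \sum_(i < n.+1) \sum_(j < n.+1) \sum_(k < n.+1 | (i + j + k == n)%N)
    lie (x i) (lie (y j) (z k)).
Proof.
apply: eq_bigr => i _; rewrite clieE lie_sumr.
have lein : (i <= n)%N by rewrite -ltnS.
have les : ((n - i).+1 <= n.+1)%N by rewrite ltnS leq_subr.
rewrite (big_ord_widen n.+1
  (fun j => lie (x i) (\sum_(k < (n - i).+1 | (j + k == n - i)%N)
     lie (y j) (z k)))) //.
rewrite big_mkcond; apply: eq_bigr => j _.
rewrite (big_ord_widen_cond n.+1 (fun k => (j + k == n - i)%N)
  (fun k => lie (y j) (z k))) // lie_sumr.
have E (k : 'I_n.+1) : (i + j + k == n)%N = (j + k == n - i)%N.
  by rewrite -addnA -(eqn_add2l i (j + k)%N) subnKC.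
case: ltnP => ij.
  apply: eq_bigl => k; rewrite E andbC; apply: andb_idl => /eqP <-.
  by rewrite ltnS leq_addl.
rewrite big1 // => k; rewrite E => /eqP jk; move: ij.
by rewrite -jk ltnNge leq_addr.
Qed.

Fact clie_jacobi (x y z : current) :
  clie x (clie y z) + clie y (clie z x) + clie z (clie x y) = 0.
Proof.
apply: currentP => n; rewrite !ccoefD ccoef0 !clie3E.
have -> : \sum_(i < n.+1) \sum_(j < n.+1) \sum_(k < n.+1 | (i + j + k == n)%N)
    lie (y i) (lie (z j) (x k)) =
  \sum_(i < n.+1) \sum_(j < n.+1) \sum_(k < n.+1 | (i + j + k == n)%N)
    lie (y j) (lie (z k) (x i)).
  under eq_bigr do under eq_bigr do rewrite big_mkcond.
  under [RHS]eq_bigr do under eq_bigr do rewrite big_mkcond.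
  rewrite [RHS]exchange_big; apply: eq_bigr => j _.
  rewrite [RHS]exchange_big; apply: eq_bigr => k _; apply: eq_bigr => i _.
  by rewrite [(j + k + i)%N]addnC addnA.
have -> : \sum_(i < n.+1) \sum_(j < n.+1) \sum_(k < n.+1 | (i + j + k == n)%N)
    lie (z i) (lie (x j) (y k)) =
  \sum_(i < n.+1) \sum_(j < n.+1) \sum_(k < n.+1 | (i + j + k == n)%N)
    lie (z k) (lie (x i) (y j)).
  under eq_bigr do under eq_bigr do rewrite big_mkcond.
  under [RHS]eq_bigr do under eq_bigr do rewrite big_mkcond.
  rewrite [LHS]exchange_big; apply: eq_bigr => i _.
  rewrite [LHS]exchange_big; apply: eq_bigr => j _; apply: eq_bigr => k _.
  by rewrite -[(k + i + j)%N]addnA [(k + _)%N]addnC.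
rewrite -!big_split big1 // => i _; rewrite -!big_split big1 // => j _.
by rewrite -!big_split big1 // => k _; exact: lie_jacobi.
Qed.

HB.instance Definition _ := Lmodule_isLie.Build K current
  clie_linearl clie_linearr cliexx clie_jacobi.

Fact tpow_fin (x : g) (r : nat) :
  exists N : nat, forall n : nat, (N <= n)%N -> (if n == r then x else 0) = 0.
Proof. by exists r.+1 => n; case: eqP => // ->; rewrite ltnn. Qed.

(* x (x) t^r *)
Definition tpow (x : g) (r : nat) : current := Current (tpow_fin x r).

End Current.

(** * The universal enveloping algebra

    [U L] is the unital associative K-algebra generated by the elements of
    [L], subject to the relations making the inclusion of [L] linear and
    [x y - y x = [x, y]].  It is built as the quotient of the formal
    non-commutative expressions by the congruence generated by the axioms of
    K-algebras and these relations; [U_lift] and [U_ext] below state its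
    universal property. *)

Section Enveloping.
Variables (K : fieldType) (L : lieAlgType K).

Inductive uterm :=
| UGen of L
| UCst of K
| UAdd of uterm & uterm
| UMul of uterm & uterm.

Inductive urel : uterm -> uterm -> Prop :=
| urel_refl a : urel a a
| urel_sym a b : urel a b -> urel b a
| urel_trans a b c : urel a b -> urel b c -> urel a c
| urel_add a a' b b' : urel a a' -> urel b b' -> urel (UAdd a b) (UAdd a' b')
| urel_mul a a' b b' : urel a a' -> urel b b' -> urel (UMul a b) (UMul a' b')
| urel_addA a b c : urel (UAdd a (UAdd b c)) (UAdd (UAdd a b) c)
| urel_addC a b : urel (UAdd a b) (UAdd b a)
| urel_add0 a : urel (UAdd (UCst 0) a) a
| urel_addN a : urel (UAdd (UMul (UCst (- 1)) a) a) (UCst 0)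
| urel_mulA a b c : urel (UMul a (UMul b c)) (UMul (UMul a b) c)
| urel_mul1 a : urel (UMul (UCst 1) a) a
| urel_mulDl a b c : urel (UMul (UAdd a b) c) (UAdd (UMul a c) (UMul b c))
| urel_mulDr a b c : urel (UMul a (UAdd b c)) (UAdd (UMul a b) (UMul a c))
| urel_cstD k l : urel (UAdd (UCst k) (UCst l)) (UCst (k + l))
| urel_cstM k l : urel (UMul (UCst k) (UCst l)) (UCst (k * l))
| urel_cstC k a : urel (UMul (UCst k) a) (UMul a (UCst k))
| urel_genD x y : urel (UGen (x + y)) (UAdd (UGen x) (UGen y))
| urel_genZ k x : urel (UGen (k *: x)) (UMul (UCst k) (UGen x))
| urel_gen_lie x y : urel (UMul (UGen x) (UGen y))
                          (UAdd (UMul (UGen y) (UGen x)) (UGen (lie x y))).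

HB.instance Definition _ := gen_eqMixin uterm.
HB.instance Definition _ := gen_choiceMixin uterm.

Definition urelb : rel uterm := fun a b => `[< urel a b >].

Fact urelb_refl : reflexive urelb.
Proof. by move=> a; apply/asboolP/urel_refl. Qed.
Fact urelb_sym : symmetric urelb.
Proof. by move=> a b; apply/asboolP/asboolP => /urel_sym. Qed.
Fact urelb_trans : transitive urelb.
Proof.
by move=> b a c /asboolP ab /asboolP bc; apply/asboolP/(urel_trans ab).
Qed.
Canonical urel_equiv := EquivRel urelb urelb_refl urelb_sym urelb_trans.

Definition U := {eq_quot urel_equiv}%qT.
HB.instance Definition _ := Choice.on U.

Definition upi (a : uterm) : U := (\pi_({eq_quot urel_equiv}) a)%qT.
Definition urepr (u : U) : uterm := repr u.

Lemma ureprK u : upi (urepr u) = u. Proof. exact: reprK. Qed.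

Lemma upiP a b : upi a = upi b <-> urel a b.
Proof.
split=> [/(@eqmodP _ urel_equiv)/asboolP //|ab].
by apply/(@eqmodP _ urel_equiv)/asboolP.
Qed.

Lemma urepr_pi a : urel (urepr (upi a)) a.
Proof. by apply/upiP; rewrite ureprK. Qed.

Lemma uind (P : U -> Prop) : (forall a, P (upi a)) -> forall u, P u.
Proof. by move=> Pa u; rewrite -(ureprK u). Qed.

Definition uadd (u v : U) : U := upi (UAdd (urepr u) (urepr v)).
Definition umul (u v : U) : U := upi (UMul (urepr u) (urepr v)).
Definition ucst (k : K) : U := upi (UCst k).
Definition uopp (u : U) : U := umul (ucst (- 1)) u.
Definition uscale (k : K) (u : U) : U := umul (ucst k) u.

Lemma upiD a b : uadd (upi a) (upi b) = upi (UAdd a b).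
Proof. by apply/upiP/urel_add; exact: urepr_pi. Qed.
Lemma upiM a b : umul (upi a) (upi b) = upi (UMul a b).
Proof. by apply/upiP/urel_mul; exact: urepr_pi. Qed.

Fact uaddA : associative uadd.
Proof.
elim/uind=> a; elim/uind=> b; elim/uind=> c; rewrite !upiD.
by apply/upiP; exact: urel_addA.
Qed.
Fact uaddC : commutative uadd.
Proof.
by elim/uind=> a; elim/uind=> b; rewrite !upiD; apply/upiP; exact: urel_addC.
Qed.
Fact uadd0 : left_id (ucst 0) uadd.
Proof. by elim/uind=> a; rewrite upiD; apply/upiP; exact: urel_add0. Qed.
Fact uaddN : left_inverse (ucst 0) uopp uadd.
Proof. by elim/uind=> a; rewrite /uopp upiM upiD; apply/upiP; exact: urel_addN. Qed.
Fact umulA : associative umul.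
Proof.
elim/uind=> a; elim/uind=> b; elim/uind=> c; rewrite !upiM.
by apply/upiP; exact: urel_mulA.
Qed.
Fact umul1 : left_id (ucst 1) umul.
Proof. by elim/uind=> a; rewrite upiM; apply/upiP; exact: urel_mul1. Qed.
Fact ucstC k u : umul (ucst k) u = umul u (ucst k).
Proof.
by elim/uind: u => a; rewrite !upiM; apply/upiP; exact: urel_cstC.
Qed.
Fact umulr1 : right_id (ucst 1) umul.
Proof. by move=> u; rewrite -ucstC umul1. Qed.
Fact umulDl : left_distributive umul uadd.
Proof.
elim/uind=> a; elim/uind=> b; elim/uind=> c; rewrite !(upiD, upiM).
by apply/upiP; exact: urel_mulDl.
Qed.
Fact umulDr : right_distributive umul uadd.
Proof.
elim/uind=> a; elim/uind=> b; elim/uind=> c; rewrite !(upiD, upiM).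
by apply/upiP; exact: urel_mulDr.
Qed.
Fact ucstD k l : uadd (ucst k) (ucst l) = ucst (k + l).
Proof. by rewrite upiD; apply/upiP; exact: urel_cstD. Qed.
Fact ucstM k l : umul (ucst k) (ucst l) = ucst (k * l).
Proof. by rewrite upiM; apply/upiP; exact: urel_cstM. Qed.

(* The augmentation, used to see that U L is not the zero ring. *)
Fixpoint uaug (a : uterm) : K :=
  match a with
  | UGen _ => 0
  | UCst k => k
  | UAdd a b => uaug a + uaug b
  | UMul a b => uaug a * uaug b
  end.

Lemma uaugP a b : urel a b -> uaug a = uaug b.
Proof.
elim=> //=.
- by move=> ? ? ? _ -> _ ->.
- by move=> ? ? ? ? _ -> _ ->.
- by move=> ? ? ? ? _ -> _ ->.
- by move=> *; rewrite addrA.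
- by move=> *; rewrite addrC.
- by move=> *; rewrite add0r.
- by move=> *; rewrite mulN1r addNr.
- by move=> *; rewrite mulrA.
- by move=> *; rewrite mul1r.
- by move=> *; rewrite mulrDl.
- by move=> *; rewrite mulrDr.
- by move=> *; rewrite mulrC.
- by move=> *; rewrite addr0.
- by move=> *; rewrite mulr0.
- by move=> *; rewrite !mulr0 addr0.
Qed.

Fact ucst1_neq0 : ucst 1 != ucst 0.
Proof. by apply/eqP => /upiP/uaugP/=/eqP; rewrite oner_eq0. Qed.

HB.instance Definition _ := GRing.isZmodule.Build U uaddA uaddC uadd0 uaddN.
HB.instance Definition _ := GRing.Zmodule_isNzRing.Build U
  umulA umul1 umulr1 umulDl umulDr ucst1_neq0.

Fact uscaleA a b (u : U) : uscale a (uscale b u) = uscale (a * b) u.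
Proof. by rewrite /uscale umulA ucstM. Qed.
Fact uscale1 : left_id 1 uscale.
Proof. exact: umul1. Qed.
Fact uscaleDr : right_distributive uscale +%R.
Proof. by move=> a u v; exact: umulDr. Qed.
Fact uscaleDl (u : U) : {morph uscale^~ u : a b / a + b}.
Proof. by move=> a b; rewrite /uscale -ucstD; exact: umulDl. Qed.
HB.instance Definition _ := GRing.Zmodule_isLmodule.Build K U
  uscaleA uscale1 uscaleDr uscaleDl.

Fact uscaleAl (k : K) (u v : U) : k *: (u * v) = (k *: u) * v.
Proof. exact: umulA. Qed.
HB.instance Definition _ := GRing.Lmodule_isLalgebra.Build K U uscaleAl.

Fact uscaleAr (k : K) (u v : U) : k *: (u * v) = u * (k *: v).
Proof.
have -> : k *: (u * v) = umul (ucst k) (umul u v) by [].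
by rewrite umulA ucstC -umulA.
Qed.
HB.instance Definition _ := GRing.Lalgebra_isAlgebra.Build K U uscaleAr.

Definition uin (x : L) : U := upi (UGen x).

Fact uin_linear : linear uin.
Proof.
move=> k x y; apply: (@etrans _ _ (uadd (umul (ucst k) (uin x)) (uin y))) => //.
rewrite upiM upiD; apply/upiP; apply: urel_trans (urel_genD _ _) _.
by apply: urel_add (urel_genZ _ _) (urel_refl _).
Qed.
HB.instance Definition _ := GRing.isLinear.Build K L U _ uin uin_linear.

Lemma uin_lie x y : uin (lie x y) = uin x * uin y - uin y * uin x.
Proof.
apply/eqP; rewrite eq_sym subr_eq addrC; apply/eqP.
have -> : uin x * uin y = umul (uin x) (uin y) by [].
have -> : uin y * uin x + uin (lie x y) =
  uadd (umul (uin y) (uin x)) (uin (lie x y)) by [].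
by rewrite !upiM upiD; apply/upiP; exact: urel_gen_lie.
Qed.

Section Universal.
Variables (A : algType K) (phi : {linear L -> A}).
Hypothesis phi_lie : forall x y, phi (lie x y) = phi x * phi y - phi y * phi x.

Fixpoint ueval (a : uterm) : A :=
  match a with
  | UGen x => phi x
  | UCst k => k%:A
  | UAdd a b => ueval a + ueval b
  | UMul a b => ueval a * ueval b
  end.

Lemma uevalP a b : urel a b -> ueval a = ueval b.
Proof.
elim=> //=.
- by move=> ? ? ? _ -> _ ->.
- by move=> ? ? ? ? _ -> _ ->.
- by move=> ? ? ? ? _ -> _ ->.
- by move=> *; rewrite addrA.
- by move=> *; rewrite addrC.
- by move=> *; rewrite scale0r add0r.
- by move=> *; rewrite scaleN1r mulN1r addNr scale0r.
- by move=> *; rewrite mulrA.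
- by move=> *; rewrite scale1r mul1r.
- by move=> *; rewrite mulrDl.
- by move=> *; rewrite mulrDr.
- by move=> *; rewrite scalerDl.
- by move=> *; rewrite mulr_algl scalerA.
- by move=> *; rewrite mulr_algl mulr_algr.
- by move=> *; rewrite linearD.
- by move=> *; rewrite mulr_algl linearZ.
- by move=> x y; rewrite phi_lie addrC subrK.
Qed.

Definition ulift (u : U) : A := ueval (urepr u).

Lemma uliftE a : ulift (upi a) = ueval a.
Proof. by apply: uevalP; exact: urepr_pi. Qed.

Fact ulift_linear : linear ulift.
Proof.
move=> k u v; elim/uind: u => a; elim/uind: v => b.
have -> : k *: upi a + upi b = uadd (umul (ucst k) (upi a)) (upi b) by [].
by rewrite upiM upiD !uliftE /= mulr_algl.
Qed.

Fact ulift_monoid : monoid_morphism ulift.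
Proof.
split=> [|u v]; first by rewrite [1]/(upi (UCst 1)) uliftE /= scale1r.
elim/uind: u => a; elim/uind: v => b.
have -> : upi a * upi b = umul (upi a) (upi b) by [].
by rewrite upiM !uliftE.
Qed.

End Universal.

Theorem U_lift (A : algType K) (phi : {linear L -> A}) :
  (forall x y, phi (lie x y) = phi x * phi y - phi y * phi x) ->
  exists psi : {lrmorphism U -> A}, forall x, psi (uin x) = phi x.
Proof.
move=> phi_lie.
pose lin := GRing.isLinear.Build K U A _ (ulift phi) (ulift_linear phi_lie).
pose mon := GRing.isMonoidMorphism.Build U A (ulift phi) (ulift_monoid phi_lie).
pose psi : {lrmorphism U -> A} := HB.pack (ulift phi) lin mon.
by exists psi => x; rewrite /= uliftE.
Qed.

Theorem U_ext (A : algType K) (psi psi' : {lrmorphism U -> A}) :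
  (forall x, psi (uin x) = psi' (uin x)) -> psi =1 psi'.
Proof.
move=> eq_gen; elim/uind; elim=> [x|k|a IHa b IHb|a IHa b IHb].
- exact: eq_gen.
- have -> : upi (UCst k) = k *: (1 : U).
    have -> : k *: (1 : U) = umul (ucst k) (ucst 1) by [].
    by rewrite ucstM mulr1.
  by rewrite !linearZ /= !rmorph1.
- have -> : upi (UAdd a b) = upi a + upi b by rewrite -upiD.
  by rewrite !rmorphD; congr (_ + _); [exact: IHa|exact: IHb].
- have -> : upi (UMul a b) = upi a * upi b by rewrite -upiM.
  by rewrite !rmorphM; congr (_ * _); [exact: IHa|exact: IHb].
Qed.

End Enveloping.

Inductive left_ideal (A : nzRingType) (S : set A) : set A :=
| left_ideal_gen s : S s -> left_ideal S s
| left_ideal_0 : left_ideal S 0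
| left_ideal_add a b : left_ideal S a -> left_ideal S b -> left_ideal S (a + b)
| left_ideal_mul a b : left_ideal S b -> left_ideal S (a * b).

(** * Type E6 *)

(* Nodes are numbered from 1 to 6; node k is the ordinal k - 1. *)
Definition node (k : nat) : 'I_6 := inord k.-1.

Definition E6_edges : seq ('I_6 * 'I_6) :=
  [:: (node 1, node 2); (node 2, node 3); (node 3, node 4); (node 4, node 5);
      (node 3, node 6)].

(* The Cartan matrix [alpha_j (h_i)]. *)
Definition cartan (i j : 'I_6) : int :=
  if i == j then 2
  else if ((i, j) \in E6_edges) || ((j, i) \in E6_edges) then -1 else 0.

(* Chevalley generators: the Cartan subalgebra is the span of the [hv i], and
   [ev i], [fv i] generate the root spaces of [alpha_i], [- alpha_i].  A simple
   Lie algebra over C is of type E6 exactly when it has such generators. *)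
Record chevalley (K : fieldType) (g : finLieAlgType K) := Chevalley {
  ev : 'I_6 -> g;
  hv : 'I_6 -> g;
  fv : 'I_6 -> g;
  lie_hh : forall i j, lie (hv i) (hv j) = 0;
  lie_he : forall i j, lie (hv i) (ev j) = (cartan i j)%:~R *: ev j;
  lie_hf : forall i j, lie (hv i) (fv j) = - ((cartan i j)%:~R *: fv j);
  lie_ef : forall i j, lie (ev i) (fv j) = if i == j then hv i else 0;
  chevalley_gen : forall V : {vspace g},
    (forall x y, x \in V -> y \in V -> lie x y \in V) ->
    (forall i, ev i \in V) -> (forall i, fv i \in V) -> V = fullv
}.

Section Roots.
Variables (K : numFieldType) (g : finLieAlgType K) (c : chevalley g).
Local Open Scope classical_set_scope.
Local Notation e := (ev c).
Local Notation h := (hv c).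
Local Notation f := (fv c).

(* An integral weight nu is given by its values [nu i] = nu(h_i). *)
Definition weight := {ffun 'I_6 -> int}.

Definition simple_root (i : 'I_6) : weight := [ffun j => cartan j i].

Definition dominant : set weight := [set lam | forall i, 0 <= lam i].

Definition supp (lam : weight) : set 'I_6 := [set i | lam i != 0].

Definition root_space (al : weight) : set g :=
  [set x | forall i, lie (h i) x = (al i)%:~R *: x].

Definition pos_root : set weight := [set al |
  [/\ al != 0,
      exists n : 'I_6 -> nat, al = \sum_i simple_root i *+ n i &
      exists2 x, root_space al x & x != 0]].

Definition cartan_subalg : {vspace g} := <<[seq h i | i : 'I_6]>>%VS.

Definition nplus : set g := [set x | exists2 s : seq g,
  (forall y, y \in s -> exists2 al, pos_root al & root_space al y) &
  x = \sum_(y <- s) y].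

Definition gcur : lieAlgType K := current g.

(* [x (x) t^r] as an element of U(g[t]). *)
Definition ut (x : g) (r : nat) : U gcur := uin (tpow x r : gcur).

Definition M_gens (i : 'I_6) (m : nat) : set (U gcur) :=
  [set a | exists2 u : gcur, (forall r, nplus (ccoef u r)) & a = uin u] `|`
  [set a | exists2 u : gcur,
     ccoef u 0 = 0 /\ (forall r, ccoef u r \in cartan_subalg) & a = uin u] `|`
  [set a | exists2 j, j != i & a = ut (h j) 0] `|`
  [set a | exists2 j, j != i & a = ut (f j) 0] `|`
  [set ut (h i) 0 - m%:R] `|`
  [set ut (f i) 0 ^+ m.+1] `|`
  [set ut (f i) 1].

(* [a v_{i,m} = 0] in M(m omega_i) = U(g[t]) / left_ideal (M_gens i m), where
   v_{i,m} is the class of 1. *)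
Definition kills (i : 'I_6) (m : nat) : set (U gcur) := left_ideal (M_gens i m).

(* x_alpha^- is any generator of the (one-dimensional) root space of - alpha,
   so the condition is imposed on the whole root space. *)
Definition R_fund (i : 'I_6) (m r : nat) : set weight := [set al |
  pos_root al /\ forall x, root_space (- al) x -> kills i m (ut x r)].

(* lam is meant to be dominant, and [`|lam i|%N] is then the natural number
   lam(h_i). *)
Definition R_weight (lam : weight) (r : nat) : set weight :=
  \bigcap_(i in [set: 'I_6]) R_fund i `|lam i|%N r.

Definition Psi_up (lam : weight) : set weight := pos_root `\` R_weight lam 1.

(* The form induced by the Killing form kappa: (mu, nu) = kappa(t_mu, t_nu)
   with t_mu in the Cartan subalgebra such that kappa(t_mu, h_j) = mu(h_j).
   For t_mu = \sum_i c_i h_i this reads c G = mu with G the Gram matrix of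
   kappa on the h_i, whence (mu, nu) = nu(t_mu) = mu G^-1 nu^T. *)
Definition killing_gram : 'M[K]_6 := \matrix_(i, j) killing (h i) (h j).

Definition weight_row (nu : weight) : 'rV[K]_6 := \row_i (nu i)%:~R.

Definition wform (mu nu : weight) : K :=
  (weight_row mu *m invmx killing_gram *m (weight_row nu)^T) 0 0.

Definition Psi_down (nu : weight) : set weight := [set al |
  pos_root al /\ forall be, pos_root be -> wform be nu <= wform al nu].

End Roots.

(* Main.v *)
Require Import Defs.
From HB Require Import structures.
From mathcomp Require Import all_boot all_order all_algebra.
From mathcomp Require Import boolp classical_sets reals zify ring.
From mathcomp.real_closed Require Import complex mxtens.

(** Write a positive root as sum_i n_i alpha_i.  Both sides of the theorem turn
    out to be conditions on the coefficients n_i.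

    On the right, the Gram matrix of the Killing form on the h_i is a positive
    multiple of the Cartan matrix, so that (alpha, omega_i) is a positive
    multiple of n_i ([wform_rt]).  For i = 2, 4, 6 the largest value of n_i is
    2, and Psi_{omega_i} is the set of roots with n_i = 2 ([Psi_downE]).

    On the left, let v be the generator of M(m omega_i).  If n_i <= 1 or m = 0,
    a root vector of -alpha, multiplied by t, kills v: it is a combination of
    brackets of the f_j where t can be moved to one entry f_j t killing v, in such
    a way that the other entries kill v as well ([kills_root_vector]).  If n_i = 2
    and m > 0 it does not kill v: this is seen in a module of g[t] with a vector
    satisfying the relations of v.  For i = 6 take g + C, where x t sends y in g
    to the number kappa(x, y) and the vector is a highest root vector.  For
    i = 2 or 4 take the tensor product of g + C with the 27-dimensional module
    of highest weight omega_5 or omega_1, and the vector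
    sum_k (-1)^k x_k (x) w_k, where the x_k are root vectors for the five
    roots with n_i = 2 and the w_k are obtained from the highest weight vector
    by lowering along the simple roots that raise x_0 to x_1, and so on
    ([chain_highest]).  For m > 1 tensor with copies of the same module on which
    t acts by 0 ([highest_neq0_nokill]).

    Thus Psi^lambda consists of the roots with n_i = 2 for some i in the support
    of lambda, i in {2, 4, 6} ([Psi_upE]): the coefficients n_1 and n_5 are at
    most 1, and lambda(h_3) = 0.  The only root with n_6 = 2 is the highest
    one, which also has n_2 = n_4 = 2.  Since 2 and 4 are not both in the support,
    Psi^lambda is empty or equal to Psi_{omega_i} for a single i.

    Two facts about an abstract algebra with Chevalley generators carry this
    out.  Its positive roots are the 36 known ones ([is_weight_list]), because
    weights are stable under simple reflections ([is_weight_refl]).  And matrices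
    that satisfy the relations of the Chevalley generators define a
    representation ([representation_of_matrices]), because the subalgebra that
    they generate together with the generators of g is a graph; this gives the
    27-dimensional modules. *)

Set Implicit Arguments.
Unset Strict Implicit.
Unset Printing Implicit Defensive.
Import Order.TTheory GRing.Theory Num.Theory.
Local Open Scope ring_scope.

(** * The root lattice of E6 *)

Lemma nodeP (P : 'I_6 -> Prop) :
  P (node 1) -> P (node 2) -> P (node 3) -> P (node 4) -> P (node 5) ->
  P (node 6) -> forall i, P i.
Proof.
move=> P1 P2 P3 P4 P5 P6; case=> m m6.
have -> : Ordinal m6 = node m.+1 by apply: val_inj; rewrite /= inordK.
by do 6![case: m m6 => [//|m] m6].
Qed.

Lemma node_eq j k : (0 < j <= 6)%N -> (0 < k <= 6)%N ->
  (node j == node k) = (j == k).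
Proof. by move=> hj hk; rewrite -val_eqE /= !inordK; lia. Qed.

Lemma sum_nodes (V : nmodType) (F : 'I_6 -> V) :
  \sum_i F i = F (node 1) + F (node 2) + F (node 3) + F (node 4) + F (node 5)
             + F (node 6).
Proof.
by rewrite 6!big_ord_recr big_ord0 /= add0r; do !congr (_ + _); congr F;
  apply: val_inj; rewrite /= inordK.
Qed.

Definition cartan_rows : seq (seq int) :=
  [:: [:: 2; -1; 0; 0; 0; 0]; [:: -1; 2; -1; 0; 0; 0];
      [:: 0; -1; 2; -1; 0; -1]; [:: 0; 0; -1; 2; -1; 0];
      [:: 0; 0; 0; -1; 2; 0]; [:: 0; 0; -1; 0; 0; 2]].

Lemma cartanE j k : (0 < j <= 6)%N -> (0 < k <= 6)%N ->
  cartan (node j) (node k) = nth 0 (nth [::] cartan_rows j.-1) k.-1.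
Proof.
move=> hj hk; rewrite /cartan /E6_edges !inE !xpair_eqE !node_eq //.
by case: j hj => [|[|[|[|[|[|[|j]]]]]]] //; case: k hk => [|[|[|[|[|[|[|k]]]]]]].
Qed.

Lemma cartan_diag i : cartan i i = 2.
Proof. by rewrite /cartan eqxx. Qed.

(** Three times the inverse of the Cartan matrix. *)
Definition cartan_adj_rows : seq (seq int) :=
  [:: [:: 4; 5; 6; 4; 2; 3]; [:: 5; 10; 12; 8; 4; 6]; [:: 6; 12; 18; 12; 6; 9];
      [:: 4; 8; 12; 10; 5; 6]; [:: 2; 4; 6; 5; 4; 3]; [:: 3; 6; 9; 6; 3; 6]].

Definition cartan_adj (i j : 'I_6) : int := nth 0 (nth [::] cartan_adj_rows i) j.

Lemma cartan_adjP i k : \sum_j cartan i j * cartan_adj j k = 3 *+ (i == k).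
Proof.
move: i k; apply: nodeP; apply: nodeP;
  by rewrite sum_nodes !cartanE // node_eq // /cartan_adj /node !inordK.
Qed.

Lemma cartan_left_injective (F : numDomainType) (a : 'I_6 -> F) :
  (forall j, \sum_i a i * (cartan i j)%:~R = 0) -> forall k, a k = 0.
Proof.
move=> a0 k; have : \sum_j (\sum_i a i * (cartan i j)%:~R) * (cartan_adj j k)%:~R = 0.
  by rewrite big1 // => j _; rewrite a0 mul0r.
under eq_bigr do rewrite mulr_suml.
rewrite exchange_big /= (bigD1 k) //= [X in _ + X]big1 ?addr0 => [|i ik].
  under eq_bigr do rewrite -mulrA -intrM.
  by rewrite -mulr_sumr -rmorph_sum cartan_adjP eqxx => /eqP;
    rewrite mulf_eq0 intr_eq0 orbF => /eqP.
under eq_bigr do rewrite -mulrA -intrM.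
by rewrite -mulr_sumr -rmorph_sum cartan_adjP (negPf ik) mulr0.
Qed.

Lemma cartanC i j : cartan i j = cartan j i.
Proof. by rewrite /cartan eq_sym [_ || _]orbC. Qed.

(** An element of the root lattice is handled through its coordinates [n] on the
    simple roots; [rt n] gives its values on the coroots. *)
Definition rt (n : weight) : weight := [ffun i => \sum_j cartan i j * n j].

Lemma rt_nodes (n : weight) :
  [/\ rt n (node 1) = 2 * n (node 1) - n (node 2),
      rt n (node 2) = 2 * n (node 2) - n (node 1) - n (node 3),
      rt n (node 3) = 2 * n (node 3) - n (node 2) - n (node 4) - n (node 6),
      rt n (node 4) = 2 * n (node 4) - n (node 3) - n (node 5) &
      rt n (node 5) = 2 * n (node 5) - n (node 4)] /\
      rt n (node 6) = 2 * n (node 6) - n (node 3).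
Proof.
by rewrite !ffunE !sum_nodes !cartanE //=; split; [split|]; lia.
Qed.

Fact rt_zmod_morphism : zmod_morphism rt.
Proof.
move=> m n; apply/ffunP=> i; rewrite !ffunE -sumrB.
by apply: eq_bigr => j _; rewrite !ffunE mulrBr.
Qed.

HB.instance Definition _ :=
  GRing.isZmodMorphism.Build weight weight rt rt_zmod_morphism.

Lemma eq_nodes (m n : weight) :
  m (node 1) = n (node 1) -> m (node 2) = n (node 2) ->
  m (node 3) = n (node 3) -> m (node 4) = n (node 4) ->
  m (node 5) = n (node 5) -> m (node 6) = n (node 6) -> m = n.
Proof. by move=> *; apply/ffunP; apply: nodeP. Qed.

Lemma rt_inj : injective rt.
Proof.
move=> m n E; have F i : rt m i = rt n i by rewrite E.
have [[m1 m2 m3 m4 m5] m6] := rt_nodes m.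
have [[n1 n2 n3 n4 n5] n6] := rt_nodes n.
move: (F (node 1)) (F (node 2)) (F (node 3)) (F (node 4)) (F (node 5)) (F (node 6)).
move: m1 m2 m3 m4 m5 m6 n1 n2 n3 n4 n5 n6 => -> -> -> -> -> -> -> -> -> -> -> ->.
by move=> *; apply: eq_nodes; lia.
Qed.

Definition nonneg (n : weight) := forall i, 0 <= n i.

(** The inverse of the Cartan matrix has positive entries, so an element with
    nonpositive values on the coroots has nonpositive coordinates. *)
Lemma nonneg_pairing n : nonneg n -> n <> 0 -> exists i, 0 < rt n i.
Proof.
move=> n0 nn0; case: (pselect (exists i, 0 < rt n i)) => // H; case: nn0.
have F i : rt n i <= 0 by rewrite leNgt; apply/negP => Hi; apply: H; exists i.
have [[m1 m2 m3 m4 m5] m6] := rt_nodes n.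
move: (F (node 1)) (F (node 2)) (F (node 3)) (F (node 4)) (F (node 5)) (F (node 6)).
move: (n0 (node 1)) (n0 (node 2)) (n0 (node 3)).
move: (n0 (node 4)) (n0 (node 5)) (n0 (node 6)).
move: m1 m2 m3 m4 m5 m6 => -> -> -> -> -> ->.
by move=> *; apply: eq_nodes; rewrite ffunE; lia.
Qed.

Definition unit_at (i : 'I_6) : weight := [ffun j => (j == i)%:Z].

Lemma rt_unit i : rt (unit_at i) = simple_root i.
Proof.
apply/ffunP=> j; rewrite !ffunE (bigD1 i) //= ffunE eqxx mulr1 big1 ?addr0 //.
by move=> k /negPf ki; rewrite ffunE ki mulr0.
Qed.

Lemma rt_unitE i j : rt (unit_at i) j = cartan j i.
Proof. by rewrite rt_unit ffunE. Qed.

Lemma rt_sum (n : 'I_6 -> nat) :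
  \sum_i simple_root i *+ n i = rt [ffun i => (n i)%:Z].
Proof.
apply/ffunP=> j; rewrite sum_ffunE ffunE; apply: eq_bigr => i _.
by rewrite ffunMnE !ffunE -mulr_natr natz.
Qed.

(** The reflection in the i-th simple root. *)
Definition refl (i : 'I_6) (n : weight) : weight := n - unit_at i *~ rt n i.

Lemma reflE i n j : refl i n j = n j - (j == i)%:Z * rt n i.
Proof.
rewrite /refl ffunE [in LHS]ffunE ffunMzE ffunE -mulrzr.
by congr (_ - _ * _); lia.
Qed.

Definition coords (n : weight) : seq int :=
  [:: n (node 1); n (node 2); n (node 3); n (node 4); n (node 5); n (node 6)].

Lemma coords_inj : injective coords.
Proof. by move=> m n [*]; apply: eq_nodes. Qed.

(** The positive roots; the simple ones come first, in the order of the nodes. *)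
Definition E6_pos : seq (seq int) :=
  [:: [:: 1; 0; 0; 0; 0; 0]; [:: 0; 1; 0; 0; 0; 0]; [:: 0; 0; 1; 0; 0; 0];
      [:: 0; 0; 0; 1; 0; 0]; [:: 0; 0; 0; 0; 1; 0]; [:: 0; 0; 0; 0; 0; 1];
      [:: 1; 1; 0; 0; 0; 0]; [:: 0; 1; 1; 0; 0; 0]; [:: 0; 0; 1; 1; 0; 0];
      [:: 0; 0; 1; 0; 0; 1]; [:: 0; 0; 0; 1; 1; 0]; [:: 1; 1; 1; 0; 0; 0];
      [:: 0; 1; 1; 1; 0; 0]; [:: 0; 1; 1; 0; 0; 1]; [:: 0; 0; 1; 1; 1; 0];
      [:: 0; 0; 1; 1; 0; 1]; [:: 1; 1; 1; 1; 0; 0]; [:: 1; 1; 1; 0; 0; 1];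
      [:: 0; 1; 1; 1; 1; 0]; [:: 0; 1; 1; 1; 0; 1]; [:: 0; 0; 1; 1; 1; 1];
      [:: 1; 1; 1; 1; 1; 0]; [:: 1; 1; 1; 1; 0; 1]; [:: 0; 1; 2; 1; 0; 1];
      [:: 0; 1; 1; 1; 1; 1]; [:: 1; 1; 2; 1; 0; 1]; [:: 1; 1; 1; 1; 1; 1];
      [:: 0; 1; 2; 1; 1; 1]; [:: 1; 2; 2; 1; 0; 1]; [:: 1; 1; 2; 1; 1; 1];
      [:: 0; 1; 2; 2; 1; 1]; [:: 1; 2; 2; 1; 1; 1]; [:: 1; 1; 2; 2; 1; 1];
      [:: 1; 2; 2; 2; 1; 1]; [:: 1; 2; 3; 2; 1; 1]; [:: 1; 2; 3; 2; 1; 2]].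

(** [rt] and [refl] on lists of coordinates, on which statements about all roots
    are decided by computation. *)
Definition lrt (k : nat) (r : seq int) : int :=
  foldr +%R 0 [seq ab.1 * ab.2 | ab <- zip (nth [::] cartan_rows k.-1) r].
Definition lrefl (k : nat) (r : seq int) : seq int :=
  set_nth 0 r k.-1 (nth 0 r k.-1 - lrt k r).

Lemma rt_coords k n : (0 < k <= 6)%N -> rt n (node k) = lrt k (coords n).
Proof.
have [[m1 m2 m3 m4 m5] m6] := rt_nodes n.
case: k => [|[|[|[|[|[|[|k]]]]]]] // _;
  rewrite ?(m1, m2, m3, m4, m5, m6) /lrt /=; lia.
Qed.

Lemma coords_refl k n : (0 < k <= 6)%N ->
  coords (refl (node k) n) = lrefl k (coords n).
Proof.
move=> hk; rewrite /coords !reflE /lrefl -/(coords n) -rt_coords //.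
case: k hk => [|[|[|[|[|[|[|k]]]]]]] // hk; rewrite !node_eq //=;
  by rewrite !(mul0r, mul1r, subr0).
Qed.

Lemma E6_pos_refl_check : all (fun k => all (fun r =>
  (lrefl k r \in E6_pos) || (r == nth [::] E6_pos k.-1)) E6_pos) (iota 1 6).
Proof. by vm_compute. Qed.

Lemma coords_unit k : (0 < k <= 6)%N ->
  coords (unit_at (node k)) = nth [::] E6_pos k.-1.
Proof.
move=> hk; rewrite /coords !ffunE !node_eq //.
by case: k hk => [|[|[|[|[|[|[|k]]]]]]].
Qed.

Lemma node_of (i : 'I_6) : exists2 k, (0 < k <= 6)%N & i = node k.
Proof.
by exists i.+1; [exact: ltn_ord|rewrite /node inord_val].
Qed.

Lemma E6_pos_refl i n : coords n \in E6_pos -> n != unit_at i ->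
  coords (refl i n) \in E6_pos.
Proof.
have [k hk ->] := node_of i => rn nu; rewrite coords_refl //.
have kin : k \in iota 1 6 by rewrite mem_iota; lia.
have /orP[//|] := allP (allP E6_pos_refl_check k kin) _ rn.
by rewrite -coords_unit // (inj_eq coords_inj) (negPf nu).
Qed.

Lemma reflK i : involutive (refl i).
Proof.
move=> n; apply/ffunP=> j; rewrite !reflE.
suff -> : rt (refl i n) i = - rt n i by rewrite mulrN opprK subrK.
rewrite raddfB raddfMz ffunE [X in _ + X]ffunE.
rewrite ffunMzE rt_unitE /cartan eqxx -mulrzr intz /=; lia.
Qed.

Definition height (n : weight) : int := \sum_i n i.

Lemma sum_mul_unit i (F : 'I_6 -> int) : \sum_j (j == i)%:Z * F j = F i.
Proof.
rewrite (bigD1 i) //= eqxx mul1r big1 ?addr0 // => j /negPf ->.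
by rewrite mul0r.
Qed.

Lemma height_refl i n : height (refl i n) = height n - rt n i.
Proof.
rewrite /height; under eq_bigr do rewrite reflE.
by rewrite sumrB (sum_mul_unit i (fun=> rt n i)).
Qed.

Lemma height_ge0 n : nonneg n -> 0 <= height n.
Proof. by move=> n0; apply: sumr_ge0. Qed.

(** Induction on the height.  A nonnegative element of [X] that is no multiple of a
    simple root is positive on some coroot.  The reflection lowers its height and leaves
    it positive, as it changes a single coordinate; and it is reached back from
    the list by the same reflection. *)
Lemma pos_in_list (X : weight -> Prop) :
  (forall n, X n -> nonneg n \/ nonneg (- n)) ->
  (forall i n, X n -> X (refl i n)) ->
  (forall i k, (1 < k)%N -> ~ X (unit_at i *+ k)) ->
  forall n, X n -> nonneg n -> n <> 0 -> coords n \in E6_pos.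
Proof.
move=> Xsgn Xrefl Xmul n Xn n0 nn0.
have [N] := ubnP `|height n|%N; elim: N n Xn n0 nn0 => // N IH n Xn n0 nn0 hN.
case: (pselect (exists2 i, n = unit_at i *+ `|n i|%N & True)) => [[i En _]|Hi].
  have ni : `|n i|%N = 1%N.
    case: (`|n i|%N) En => [|[|k]] En //.
    by case: (Xmul i k.+2); rewrite // -En.
  have [k hk Ek] := node_of i.
  by rewrite En ni mulr1n Ek coords_unit // mem_nth //=; lia.
have [i pi] := nonneg_pairing n0 nn0.
have Xr := Xrefl i n Xn.
have [j jNi nj] : exists2 j, j != i & 0 < n j.
  case: (pselect (exists2 j, j != i & 0 < n j)) => // Hj; case: Hi; exists i => //.
  apply/ffunP=> j; rewrite ffunMnE ffunE; case: (eqVneq j i) => [->|ji].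
    by have := n0 i; rewrite -mulr_natr mul1r natz gez0_abs.
  rewrite mul0rn; apply/eqP; rewrite eq_le n0 andbT leNgt.
  by apply/negP => nj; apply: Hj; exists j.
have rj : refl i n j = n j by rewrite reflE (negPf jNi) mul0r subr0.
have r0 : nonneg (refl i n).
  by case: (Xsgn _ Xr) => // /(_ j); rewrite ffunE rj; lia.
have rn0 : refl i n <> 0 by move=> E; move: rj; rewrite E ffunE; lia.
have rl : coords (refl i n) \in E6_pos.
  apply: IH => //; rewrite height_refl.
  by move: (height_ge0 n0) (height_ge0 r0) pi hN; rewrite height_refl; lia.
rewrite -[n](reflK i) E6_pos_refl //; apply/eqP => E.
by move: rj; rewrite E ffunE (negPf jNi); lia.
Qed.

Lemma lrefl_chain (X : weight -> Prop) (s : seq nat) n :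
  (forall i m, X m -> X (refl i m)) -> all (fun k => 0 < k <= 6)%N s ->
  X n -> exists2 m, X m & coords m = foldl (fun r k => lrefl k r) (coords n) s.
Proof.
move=> Xrefl; elim: s n => [|k s IH] n /=; first by exists n.
by move=> /andP[hk hs] Xn; rewrite -coords_refl //; apply: IH => //; apply: Xrefl.
Qed.

(** The highest root. *)
Definition theta : weight := [ffun i : 'I_6 => nth 0 [:: 1; 2; 3; 2; 1; 2] i].

Lemma coords_theta : coords theta = [:: 1; 2; 3; 2; 1; 2].
Proof. by rewrite /coords !ffunE /= !inordK. Qed.

Lemma theta_in (X : weight -> Prop) :
  (forall i m, X m -> X (refl i m)) -> X (unit_at (node 1)) -> X theta.
Proof.
move=> Xrefl X1.
(* reflections leading from alpha_1 to the highest root, raising each time *)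
pose s := [:: 2; 3; 4; 5; 6; 3; 2; 4; 3; 6]%N.
have [m Xm Em] := lrefl_chain (s := s) Xrefl isT X1.
suff -> : theta = m by [].
apply: coords_inj; rewrite Em coords_theta coords_unit //.
Qed.

(** * The triangular decomposition *)

(** A family of maximal size among the free ones drawn from [S]: this is how the
    span of an infinite set is handled. *)
Lemma free_generating_seq (K : fieldType) (V : vectType K) (S : set V) :
  exists b : seq V, [/\ free b, forall x, x \in b -> S x &
    forall x, S x -> x \in <<b>>%VS].
Proof.
have [//|H] := pselect (exists b : seq V, [/\ free b,
  forall x, x \in b -> S x & forall x, S x -> x \in <<b>>%VS]).
have {}H b : free b -> (forall x, x \in b -> S x) ->
    exists2 x, S x & x \notin <<b>>%VS.
  move=> fb bS; have [//|H'] := pselect (exists2 x, S x & x \notin <<b>>%VS).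
  case: H; exists b; split=> // x Sx; apply/negPn/negP => xb.
  by apply: H'; exists x.
have [b [fb _ sb]] : exists b : seq V, [/\ free b, forall x, x \in b -> S x &
    size b = (\dim {:V}).+1].
  elim: (\dim _).+1 => [|n [b [fb bS sb]]].
    by exists [::]; rewrite /free span_nil dimv0.
  have [x Sx xb] := H b fb bS; exists (x :: b); split.
  - by rewrite free_cons xb.
  - by move=> y; rewrite inE => /predU1P[->//|/bS].
  - by rewrite /= sb.
have := dimvS (subvf <<b>>%VS).
by rewrite (eqP fb) sb ltnn.
Qed.

Lemma vspace_of_linear_set (K : fieldType) (V : vectType K) (S : set V) : S 0 ->
  (forall k x y, S x -> S y -> S (k *: x + y)) ->
  exists W : {vspace V}, forall x, x \in W <-> S x.
Proof.
move=> S0 Slin; have [b [_ bS Sb]] := free_generating_seq S.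
exists <<b>>%VS => x; split=> [xb|/Sb//].
rewrite (coord_span (X := in_tuple b) xb).
apply: (big_ind S) => // [y z Sy Sz|k _]; first by rewrite -[y]scale1r; apply: Slin.
by rewrite -[_ *: _]addr0; apply: Slin => //; apply: bS; rewrite mem_nth.
Qed.

Section Jacobi.
Variables (K : fieldType) (g : lieAlgType K).
Implicit Types x y z : g.

Lemma lieNl x y : lie (- x) y = - lie x y.
Proof. by rewrite -scaleN1r lieZl scaleN1r. Qed.

Lemma lieNr x y : lie x (- y) = - lie x y.
Proof. by rewrite -scaleN1r lieZr scaleN1r. Qed.

Lemma lie_deriv x y z : lie x (lie y z) = lie (lie x y) z + lie y (lie x z).
Proof.
rewrite [lie (lie x y) z]lieC [lie x z]lieC lieNr.
apply/eqP; rewrite -subr_eq0 opprD !opprK addrA addrAC.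
by rewrite lie_jacobi.
Qed.
End Jacobi.

Section ChevalleyTheory.
Variables (K : numFieldType) (g : finLieAlgType K).
Implicit Types (c : chevalley g) (x y z : g) (a b n : weight).

Lemma root_space_lin c a (k : K) x y : root_space c a x -> root_space c a y ->
  root_space c a (k *: x + y).
Proof.
by move=> hx hy i; rewrite lieDr lieZr hx hy scalerDr !scalerA mulrC.
Qed.

Lemma root_space0 c a : root_space c a 0.
Proof. by move=> i; rewrite lie0r scaler0. Qed.

Lemma root_spaceZ c a (k : K) x : root_space c a x -> root_space c a (k *: x).
Proof. by move=> hx; rewrite -[_ *: _]addr0; apply/root_space_lin/root_space0. Qed.

Lemma root_space_lie c a b x y : root_space c a x -> root_space c b y ->
  root_space c (a + b) (lie x y).
Proof.
move=> hx hy i; rewrite lie_deriv hx hy lieZl lieZr -scalerDl ffunE.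
by rewrite intrD.
Qed.

Lemma root_space_e c i : root_space c (rt (unit_at i)) (ev c i).
Proof. by move=> j; rewrite rt_unitE lie_he. Qed.

Lemma root_space_f c i : root_space c (rt (- unit_at i)) (fv c i).
Proof.
by move=> j; rewrite raddfN ffunE rt_unitE lie_hf intrN scaleNr.
Qed.

Lemma root_space_h c i : root_space c (rt 0) (hv c i).
Proof. by move=> j; rewrite raddf0 ffunE scale0r lie_hh. Qed.

(** The innermost letter [j] is kept apart, so that the words are nonempty. *)
Definition ebr c (w : seq 'I_6) (j : 'I_6) : g :=
  foldr (fun i => lie (ev c i)) (ev c j) w.

Definition content (w : seq 'I_6) (j : 'I_6) : weight :=
  unit_at j + \sum_(i <- w) unit_at i.

Lemma content_cons i w j : content (i :: w) j = unit_at i + content w j.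
Proof. by rewrite /content big_cons addrCA. Qed.

Lemma ebr_space c w j : root_space c (rt (content w j)) (ebr c w j).
Proof.
elim: w => [|i w IH] /=.
  by rewrite /content big_nil addr0; apply: root_space_e.
by rewrite content_cons raddfD; apply/root_space_lie/IH/root_space_e.
Qed.

Lemma content_ge0 w j : nonneg (content w j).
Proof.
move=> i; rewrite /content ffunE sum_ffunE addr_ge0 ?sumr_ge0 ?ffunE //.
by move=> k _; rewrite ffunE.
Qed.

Lemma content_neq0 w j : content w j <> 0.
Proof.
move=> /ffunP/(_ j); rewrite /content 2!ffunE eqxx ffunE.
have : 0 <= (\sum_(i <- w) unit_at i) j.
  by rewrite sum_ffunE sumr_ge0 // => i _; rewrite ffunE.
by case: (_ j) => /= *; lia.
Qed.

Fact opp_hh c i j : lie (- hv c i) (- hv c j) = 0.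
Proof. by rewrite lieNl lieNr opprK lie_hh. Qed.
Fact opp_he c i j : lie (- hv c i) (fv c j) = (cartan i j)%:~R *: fv c j.
Proof. by rewrite lieNl lie_hf opprK. Qed.
Fact opp_hf c i j : lie (- hv c i) (ev c j) = - ((cartan i j)%:~R *: ev c j).
Proof. by rewrite lieNl lie_he. Qed.
Fact opp_ef c i j : lie (fv c i) (ev c j) = if i == j then - hv c i else 0.
Proof.
by rewrite lieC lie_ef eq_sym; case: eqP => [->|]; rewrite ?oppr0.
Qed.
Fact opp_gen c (V : {vspace g}) :
  (forall x y, x \in V -> y \in V -> lie x y \in V) ->
  (forall i, fv c i \in V) -> (forall i, ev c i \in V) -> V = fullv.
Proof. by move=> Vlie Vf Ve; apply: (chevalley_gen (c := c)). Qed.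

(** The Chevalley involution, which transfers to the [fv c i] what is proved for
    the [ev c i]. *)
Definition chev_opp c : chevalley g :=
  Chevalley (opp_hh c) (opp_he c) (opp_hf c) (opp_ef c) (opp_gen (c := c)).

Lemma root_space_opp c a x : root_space (chev_opp c) a x <-> root_space c (- a) x.
Proof.
split=> hx i; have := hx i; rewrite /= lieNl ffunE intrN scaleNr.
  by move <-; rewrite opprK.
by move->; rewrite opprK.
Qed.

Lemma chevalley_eq c c' : ev c = ev c' -> hv c = hv c' -> fv c = fv c' -> c = c'.
Proof.
case: c c' => [e h f hh he hf ef gen] [e' h' f' hh' he' hf' ef' gen'] /=.
by move=> *; subst; congr Chevalley; apply: Prop_irrelevance.
Qed.

Lemma chev_oppK : involutive chev_opp.
Proof. by move=> c; apply: chevalley_eq => //=; apply/funext => i; rewrite opprK. Qed.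

(** A spanning set of the Borel subalgebra. *)
Definition upper c : set g :=
  [set x | (exists w j, x = ebr c w j) \/ exists i, x = hv c i]%classic.

Definition lower c := upper (chev_opp c).

Lemma upper_ad_e c i x : upper c x -> exists y k, upper c y /\ lie (ev c i) x = k *: y.
Proof.
case=> [[w [j ->]]|[j ->]].
  by exists (ebr c (i :: w) j), 1; rewrite scale1r; split=> //; left; exists (i :: w), j.
exists (ebr c [::] i), (- (cartan j i)%:~R); split; first by left; exists [::], i.
by rewrite lieC lie_he scaleNr.
Qed.

Lemma upper_ad_f c (V : {vspace g}) i : (forall x, upper c x -> x \in V) ->
  (forall i x, x \in V -> lie (ev c i) x \in V) ->
  forall w j, lie (fv c i) (ebr c w j) \in V.
Proof.
move=> SV Ve; elim=> [|k w IH] j /=.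
  rewrite (lie_ef (chev_opp c) i j) /=; case: eqP => _; rewrite ?mem0v //.
  by rewrite memvN; apply: SV; right; exists i.
rewrite lie_deriv (lie_ef (chev_opp c) i k) /= rpredD ?Ve //.
case: eqP => _; rewrite ?lie0l ?mem0v // lieNl memvN ebr_space memvZ //.
by apply: SV; left; exists w, j.
Qed.

Lemma stable_ad_e c : exists2 V : {vspace g}, (forall x, upper c x -> x \in V) &
  (forall i x, x \in V -> lie (ev c i) x \in V) /\
  exists b : seq g, (forall x, x \in b -> upper c x) /\ V = <<b>>%VS.
Proof.
have [b [_ bS Sb]] := free_generating_seq (upper c); exists <<b>>%VS => //.
split=> [i x xb|]; last by exists b.
rewrite (coord_span (X := in_tuple b) xb) lie_sumr rpred_sum // => k _.
rewrite lieZr memvZ //.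
have [y [l [Sy ->]]] := upper_ad_e i (bS _ (mem_nth 0 (ltn_ord k))).
by rewrite memvZ ?Sb.
Qed.

(** The sum of the two triangular parts is stable under the generators, hence
    under [g] by the Jacobi identity; being an ideal that contains the
    generators, it is everything. *)
Lemma triangular_span c (V : {vspace g}) :
  (forall x, upper c x -> x \in V) -> (forall x, lower c x -> x \in V) ->
  V = fullv.
Proof.
move=> uV lV; have [Vp Sp [ep [bp [bpS dp]]]] := stable_ad_e c.
have [Vm Sm [em [bm [bmS dm]]]] := stable_ad_e (chev_opp c).
have WV : (Vp + Vm <= V)%VS.
  rewrite dp dm subv_add; apply/andP; split; apply/span_subvP => x xb.
    exact/uV/bpS.
  exact/lV/bmS.
suff W_full : (Vp + Vm)%VS = fullv.
  by apply/vspaceP => x; rewrite memvf (subvP WV) // W_full memvf.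
have stab c' (V1 V2 : {vspace g}) (b1 b2 : seq g) :
    (forall x, upper c' x -> x \in V1) ->
    (forall i x, x \in V1 -> lie (ev c' i) x \in V1) ->
    (forall x, lower c' x -> x \in V2) ->
    (forall i x, x \in V2 -> lie (fv c' i) x \in V2) ->
    (forall x, x \in b2 -> lower c' x) -> V2 = <<b2>>%VS ->
    forall i x, x \in (V1 + V2)%VS -> lie (ev c' i) x \in (V1 + V2)%VS.
  move=> S1 e1 S2 e2 b2S d2 i _ /memv_addP[x1 x1V [x2 x2V ->]].
  rewrite lieDr rpredD //; first by rewrite (subvP (addvSl _ _)) ?e1.
  move: x2V; rewrite d2 => x2b.
  rewrite (coord_span (X := in_tuple b2) x2b) lie_sumr rpred_sum // => k _.
  rewrite lieZr memvZ //.
  case: (b2S _ (mem_nth 0 (ltn_ord k))) => [[w [j ->]]|[j ->]].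
    rewrite -d2 (subvP (addvSr _ _)) //.
    exact: (upper_ad_f (c := chev_opp c') i S2 e2).
  rewrite (subvP (addvSl _ _)) // lieNr lieC lie_he opprK memvZ // S1 //.
  by left; exists [::], i.
have stab_e := stab c Vp Vm bp bm Sp ep Sm em bmS dm.
have stab_f i x : x \in (Vp + Vm)%VS -> lie (fv c i) x \in (Vp + Vm)%VS.
  rewrite addvC; apply: (stab (chev_opp c) Vm Vp bm bp) => //;
    by rewrite /lower chev_oppK.
have [W dW] : exists W : {vspace g}, forall y, y \in W <->
    forall x, x \in (Vp + Vm)%VS -> lie y x \in (Vp + Vm)%VS.
  apply: vspace_of_linear_set => [x _|k y z yW zW x xW].
    by rewrite lie0l mem0v.
  by rewrite lie_linearl rpredD ?memvZ ?yW ?zW.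
have W_all : W = fullv.
  apply: (chevalley_gen (c := c)) => [x y /dW xW /dW yW|i|i].
  - apply/dW => z zW; have /eqP := lie_deriv x y z.
    by rewrite -subr_eq => /eqP <-; rewrite rpredB ?xW ?yW // ?xW // yW.
  - exact/dW/stab_e.
  - exact/dW/stab_f.
apply: (chevalley_gen (c := c)) => [x y xW yW|i|i].
- by have /dW : x \in W by [rewrite W_all memvf]; apply.
- by rewrite (subvP (addvSl _ _)) // Sp //; left; exists [::], i.
- by rewrite (subvP (addvSr _ _)) // Sm //; left; exists [::], i.
Qed.
End ChevalleyTheory.

(** * Homogeneous bases *)

Section GradedBasis.
Variables (K : numFieldType) (g : finLieAlgType K).
Implicit Types (c : chevalley g) (x y z : g) (a b n : weight).

(** Iterated brackets, and elements of the Cartan subalgebra, together with their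
    degree in the root lattice; [g] has a basis made of such elements. *)
Definition graded c n x :=
  [\/ exists w j, n = content w j /\ x = ebr c w j,
      n = 0 /\ x \in cartan_subalg c |
      exists w j, n = - content w j /\ x = ebr (chev_opp c) w j].

Lemma graded_root_space c n x : graded c n x -> root_space c (rt n) x.
Proof.
case=> [[w [j [-> ->]]]|[-> xh]|[w [j [-> ->]]]]; first exact: ebr_space.
  have := xh; rewrite /cartan_subalg => xh'.
  rewrite (coord_span (X := in_tuple _) xh').
  apply: (big_ind (fun y => root_space c (rt 0) y)).
  - exact: root_space0.
  - by move=> y z hy hz; rewrite -[y]scale1r; apply: root_space_lin.
  - move=> k _; apply: root_spaceZ => i.
    have /mapP[j _ ->] : (in_tuple [seq hv c i | i : 'I_6])`_k
      \in [seq hv c i | i : 'I_6] by rewrite mem_nth.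
    exact: root_space_h.
rewrite raddfN; apply/(root_space_opp c).
exact: (ebr_space (chev_opp c)).
Qed.

Lemma hv_cartan c i : hv c i \in cartan_subalg c.
Proof. by apply/memv_span/mapP; exists i => //; rewrite mem_enum. Qed.

Lemma graded_basis c : exists (b : (\dim {:g}).-tuple g) (n : 'I_(\dim {:g}) -> weight),
  basis_of fullv b /\ forall k, graded c (n k) b`_k.
Proof.
have [b [fb bS Sb]] :=
  free_generating_seq [set x | upper c x \/ lower c x]%classic.
have bfull : <<b>>%VS = fullv.
  by apply: (triangular_span (c := c)) => x Sx; apply: Sb; [left|right].
have sb : size b == \dim {:g} by rewrite -bfull (eqP fb).
have bn k : exists n, graded c n (Tuple sb)`_k.
  case: (ltnP k (size b)) => [kb|kb]; last first.
    by rewrite nth_default //; exists 0; apply: Or32; rewrite mem0v.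
  have /bS : b`_k \in b by rewrite mem_nth.
  case=> -[[w [j E]]|[j E]]; rewrite /= E.
  - by exists (content w j); apply: Or31; exists w, j.
  - by exists 0; apply: Or32; rewrite hv_cartan.
  - by exists (- content w j); apply: Or33; exists w, j.
  - by exists 0; apply: Or32; rewrite memvN hv_cartan.
have [n nP] := choice bn; exists (Tuple sb), (fun k => n k); split=> //.
by rewrite /basis_of /= bfull eqxx fb.
Qed.

Lemma coord_root_space c m (b : m.-tuple g) (n : 'I_m -> weight) :
  basis_of fullv b -> (forall k, root_space c (rt (n k)) b`_k) ->
  forall a x, root_space c (rt a) x -> forall k, coord b k x != 0 -> n k = a.
Proof.
move=> bb bn a x xa k xk; apply: rt_inj; apply/ffunP=> i.
have := xa i; rewrite {1 2}(coord_basis bb (memvf x)).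
rewrite lie_sumr scaler_sumr.
under eq_bigr do rewrite lieZr bn scalerA.
under [RHS]eq_bigr do rewrite scalerA.
move/(congr1 (coord b k)); rewrite !coord_sum_free ?(basis_free bb) // mulrC.
by move/(mulIf xk)/eqP; rewrite eqr_int => /eqP.
Qed.

(** A vector of weight [rt n] only involves basis elements of degree [n], because
    [rt] is injective. *)
Lemma root_space_ind c n (P : g -> Prop) : P 0 ->
  (forall k x y, P x -> P y -> P (k *: x + y)) ->
  (forall x, graded c n x -> P x) -> forall x, root_space c (rt n) x -> P x.
Proof.
move=> P0 Plin Pgr x xn; have [b [m [bb bm]]] := graded_basis c.
have bm' k := graded_root_space (bm k).
rewrite (coord_basis bb (memvf x)); apply: (big_ind P) => // [y z Py Pz|k _].
  by rewrite -[y]scale1r; apply: Plin.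
have [->|xk] := eqVneq (coord b k x) 0; first by rewrite scale0r.
rewrite -[_ *: _]addr0; apply: Plin => //; apply: Pgr.
by rewrite -(coord_root_space bb bm' xn xk).
Qed.

Lemma root_space_sign c n x : root_space c (rt n) x -> x != 0 ->
  nonneg n \/ nonneg (- n).
Proof.
move=> xn; apply: contra_neqP => Hn.
move: x xn; apply: root_space_ind => // [k x y -> ->|x]; first by rewrite scaler0 addr0.
case=> [[w [j [En _]]]|[En _]|[w [j [En _]]]]; case: Hn; rewrite En.
- by left; apply: content_ge0.
- by left=> i; rewrite ffunE.
- by right; rewrite opprK; apply: content_ge0.
Qed.

Lemma root_space_pos_ind c n (P : g -> Prop) : P 0 ->
  (forall k x y, P x -> P y -> P (k *: x + y)) ->
  (forall w j, content w j = n -> P (ebr c w j)) ->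
  nonneg n -> n <> 0 -> forall x, root_space c (rt n) x -> P x.
Proof.
move=> P0 Plin Pe n0 nn0; apply: root_space_ind => // x.
case=> [[w [j [En ->]]]|[En _]|[w [j [En _]]]]; [exact: Pe|by []|].
case: (@content_neq0 w j); apply/ffunP=> i; rewrite [RHS]ffunE; apply/eqP.
by have := n0 i; rewrite En ffunE oppr_ge0 eq_le => ->; rewrite content_ge0.
Qed.

Lemma root_space_zero c x : root_space c (rt 0) x -> x \in cartan_subalg c.
Proof.
move: x; apply: root_space_ind => [|k x y|x].
- exact: mem0v.
- by move=> ? ?; rewrite rpredD ?memvZ.
case=> [[w [j [En _]]]|[_ //]|[w [j [En _]]]]; case: (@content_neq0 w j) => //.
by rewrite -[LHS]opprK -En oppr0.
Qed.

(** The innermost bracket is that of [ev c i] with itself. *)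
Lemma ebr_multiple c w j i k : content w j = unit_at i *+ k.+2 -> ebr c w j = 0.
Proof.
move=> E.
have allE l : l \in j :: w -> l = i.
  move=> lw; apply/eqP; apply: contraT => li.
  move/ffunP/(_ l): E; rewrite /content -(big_cons 0 +%R j w xpredT) sum_ffunE.
  rewrite ffunMnE [unit_at i l]ffunE (negPf li) mul0rn.
  rewrite (big_rem l) //= ffunE eqxx.
  have : 0 <= \sum_(m <- rem l (j :: w)) unit_at m l.
    by apply: sumr_ge0 => m _; rewrite ffunE.
  by case: (\sum_(_ <- _) _) => //= *; lia.
have w0 : w <> [::].
  move=> w0; move/ffunP/(_ i): E; rewrite w0 /content big_nil addr0 ffunMnE !ffunE.
  by rewrite [j]allE ?mem_head // eqxx -mulr_natr mul1r natz.
rewrite [j]allE ?mem_head //; have {}allE l : l \in w -> l = i.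
  by move=> lw; apply: allE; rewrite inE lw orbT.
case: w {E} w0 allE => // l w _; elim: w l => [|l' w IH] l allE.
  by rewrite /= [l]allE ?mem_head // liexx.
have -> : ebr c [:: l, l' & w] i = lie (ev c l) (ebr c (l' :: w) i) by [].
rewrite IH ?lie0r // => l2 l2w.
by apply: allE; rewrite inE l2w orbT.
Qed.

Lemma root_space_multiple c i k x : (1 < k)%N ->
  root_space c (rt (unit_at i *+ k)) x -> x = 0.
Proof.
case: k => [|[|k]] // _; move: x; apply: root_space_pos_ind => //.
- by move=> k' x y -> ->; rewrite scaler0 addr0.
- by move=> w j; apply: ebr_multiple.
- by move=> j; rewrite ffunMnE ffunE mulrn_wge0.
- move/ffunP/(_ i); rewrite ffunMnE !ffunE eqxx -mulr_natr mul1r.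
  by rewrite natz.
Qed.

Lemma finite_weights c : exists s : seq weight,
  forall n x, root_space c (rt n) x -> x != 0 -> n \in s.
Proof.
have [b [m [bb bm]]] := graded_basis c.
have bm' k := graded_root_space (bm k).
exists (codom m) => n x xn; apply: contraNT => nm.
rewrite (coord_basis bb (memvf x)) big1 // => k _.
have [->|xk] := eqVneq (coord b k x) 0; first by rewrite scale0r.
by move: nm; rewrite -(coord_root_space bb bm' xn xk) codom_f.
Qed.

End GradedBasis.

(** * Strings of weights and the list of roots *)

Lemma unit_mulE i k : (unit_at i *+ k) i = k%:Z.
Proof. by rewrite ffunMnE ffunE eqxx natz. Qed.

Lemma rt_add_unit (n : weight) i k : rt (n + unit_at i *+ k) i = rt n i + (2 * k)%N%:Z.
Proof.
rewrite raddfD raddfMn ffunE ffunMnE /= rt_unitE /cartan eqxx.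
by lia.
Qed.

Lemma rt_sub_unit (n : weight) i k : rt (n - unit_at i *+ k) i = rt n i - (2 * k)%N%:Z.
Proof.
rewrite raddfB raddfMn ffunE [X in _ + X]ffunE ffunMnE /= rt_unitE /cartan eqxx.
by lia.
Qed.

Section Strings.
Variables (K : numFieldType) (g : finLieAlgType K).
Implicit Types (c : chevalley g) (x y z : g) (a b n : weight).

Lemma root_space_iter_e c i n x k : root_space c (rt n) x ->
  root_space c (rt (n + unit_at i *+ k)) (iter k (lie (ev c i)) x).
Proof.
move=> xn; elim: k => [|k IH]; first by rewrite mulr0n addr0.
rewrite iterS mulrS addrCA raddfD; apply: root_space_lie IH.
exact: root_space_e.
Qed.

Lemma root_space_iter_f c i n x k : root_space c (rt n) x ->
  root_space c (rt (n - unit_at i *+ k)) (iter k (lie (fv c i)) x).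
Proof.
move=> xn; elim: k => [|k IH]; first by rewrite mulr0n subr0.
rewrite iterS mulrS opprD addrCA raddfD; apply: root_space_lie IH.
exact: root_space_f.
Qed.

Lemma root_space_oppE c a : root_space (chev_opp c) a = root_space c (- a).
Proof. by apply/funext => x; apply/propext/root_space_opp. Qed.

(** The nonzero iterates have distinct weights, of which there are finitely many. *)
Lemma ad_e_nilp c i n x : root_space c (rt n) x -> x != 0 ->
  exists2 k, iter k (lie (ev c i)) x != 0 & lie (ev c i) (iter k (lie (ev c i)) x) = 0.
Proof.
move=> xn x0; have [s sP] := finite_weights c.
have [k kP] : exists k, iter k (lie (ev c i)) x = 0.
  have [//|H] := pselect (exists k, iter k (lie (ev c i)) x = 0).
  have {}H k : n + unit_at i *+ k \in s.
    apply: sP (root_space_iter_e i k xn) _.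
    by apply/eqP => E; apply: H; exists k.
  have inj : injective (fun k => n + unit_at i *+ k).
    by move=> k l /addrI/ffunP/(_ i); rewrite !unit_mulE => -[].
  pose s1 := [seq n + unit_at i *+ k | k <- iota 0 (size s).+1].
  have := uniq_leq_size (s1 := s1) (s2 := s).
  rewrite (map_inj_uniq inj) iota_uniq size_map size_iota ltnn.
  by move=> /(_ isT) F; suff: false by []; apply: F => _ /mapP[k _ ->].
elim: k kP => [|k IH] /=; first by move/eqP; rewrite (negPf x0).
have [/IH//|nz E] := eqVneq (iter k (lie (ev c i)) x) 0.
by exists k => //; apply/eqP.
Qed.

(** The computation in sl2: [e] maps f^(k+1) y to (k+1)(a - k) times f^k y, where
    a is the weight of y.  Since f^k y vanishes for some k, the first such k is
    a + 1. *)
Lemma highest_string c i n y : root_space c (rt n) y -> y != 0 ->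
  lie (ev c i) y = 0 -> exists2 m : nat, rt n i = m &
  forall k, (k <= m)%N -> iter k (lie (fv c i)) y != 0.
Proof.
move=> yn y0 ey.
have ef k : lie (ev c i) (iter k.+1 (lie (fv c i)) y) =
    ((k.+1)%:R * ((rt n i)%:~R - k%:R)) *: iter k (lie (fv c i)) y.
  elim: k => [|k IH].
    by rewrite /= lie_deriv ey lie0r addr0 lie_ef eqxx yn mul1r subr0.
  rewrite iterS lie_deriv IH lie_ef eqxx.
  rewrite (root_space_iter_f i k.+1 yn i) lieZr -iterS -scalerDl.
  congr (_ *: _); rewrite rt_sub_unit intrB -pmulrn.
  by rewrite natrM -!natr1; ring.
have [k nz kz] : exists2 k, iter k (lie (fv c i)) y != 0 &
    lie (fv c i) (iter k (lie (fv c i)) y) = 0.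
  apply: (@ad_e_nilp (chev_opp c) i (- n)) y0.
  by rewrite root_space_oppE -raddfN opprK.
exists k.
  have := ef k; rewrite iterS kz lie0r => /esym/eqP; rewrite scaler_eq0 (negPf nz) orbF.
  rewrite mulf_eq0 pnatr_eq0 /= subr_eq0 => /eqP E.
  by apply/eqP; rewrite -(eqr_int K) E.
move=> j /subnKC E; apply: contraNneq nz => z; rewrite -E addnC iterD z.
by elim: (k - j)%N => //= l /eqP ->; rewrite lie0r.
Qed.

Definition is_weight c n := exists2 x, root_space c (rt n) x & x != 0.

Lemma is_weight_opp c n : is_weight (chev_opp c) n = is_weight c (- n).
Proof.
by rewrite /is_weight root_space_oppE -raddfN.
Qed.

(** The reflected weight is met by going up to the top of the string through [n],
    and down again by [f]. *)
Lemma is_weight_refl c i n : is_weight c n -> is_weight c (refl i n).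
Proof.
wlog pos : c n / 0 <= rt n i => [H|].
  have [|neg] := leP 0 (rt n i); first exact: H.
  move=> nW; have /(_ (chev_opp c) (- n)) := H.
  rewrite raddfN ffunE oppr_ge0 ltW // is_weight_opp opprK => /(_ isT nW).
  rewrite is_weight_opp; congr is_weight.
  by rewrite /refl raddfN ffunE mulrNz opprB addrC opprK; congr (_ - _).
move=> [x xn x0]; have [p ep eep] := ad_e_nilp i xn x0.
have yn := root_space_iter_e i p xn.
have [m Em mP] := highest_string yn ep eep.
have pm : (`|rt n i| + p <= m)%N.
  by move: Em; rewrite rt_add_unit; lia.
exists (iter (`|rt n i| + p) (lie (fv c i)) (iter p (lie (ev c i)) x)); last exact: mP.
have := root_space_iter_f i (`|rt n i| + p) yn; congr (root_space _ (rt _) _).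
by rewrite mulrnDr opprD addrACA subrr addr0 /refl -[in RHS](gez0_abs pos).
Qed.

(** The diagram being connected, one vanishing generator makes the others
    vanish. *)
Lemma chevalley_eq0 c i : ev c i = 0 -> forall x : g, x = 0.
Proof.
move=> ei.
have h0 j : ev c j = 0 -> hv c j = 0.
  by move=> ej; have := lie_ef c j j; rewrite eqxx ej lie0l.
have step j k : ev c j = 0 -> cartan j k != 0 -> ev c k = 0.
  move=> /h0 hj a; have /esym/eqP := lie_he c j k.
  by rewrite hj lie0l scaler_eq0 intr_eq0 (negPf a) => /eqP.
have e0 : forall j, ev c j = 0.
  have e3 : ev c (node 3) = 0.
    have [k hk Ek] := node_of i; move: ei; rewrite Ek => ei.
    case: k hk ei {Ek} => [|[|[|[|[|[|[|k]]]]]]] // _ ei;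
      try by apply: step ei _; rewrite cartanE.
    - by apply: (@step (node 2)); rewrite ?cartanE //; apply: step ei _; rewrite cartanE.
    - by apply: (@step (node 4)); rewrite ?cartanE //; apply: step ei _; rewrite cartanE.
  have e2 : ev c (node 2) = 0 by apply: step e3 _; rewrite cartanE.
  have e4 : ev c (node 4) = 0 by apply: step e3 _; rewrite cartanE.
  by apply: nodeP => //; [apply: step e2 _|apply: step e4 _|apply: step e3 _];
    rewrite cartanE.
have f0 j : fv c j = 0.
  have /eqP := lie_hf c j j; rewrite (h0 _ (e0 j)) lie0l eq_sym oppr_eq0 scaler_eq0.
  by rewrite /cartan eqxx intr_eq0 => /eqP.
have V0 : 0%VS = fullv :> {vspace g}.
  apply: (chevalley_gen (c := c)) => [x y|j|j]; rewrite ?e0 ?f0 ?mem0v //.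
  by rewrite !memv0 => /eqP -> _; rewrite lie0l.
by move=> x; apply/eqP; rewrite -memv0 V0 memvf.
Qed.

Lemma is_weight_simple c i : (exists x : g, x != 0) -> is_weight c (unit_at i).
Proof.
move=> [x x0]; exists (ev c i); first exact: root_space_e.
by apply: contra_neqN x0 => /eqP/chevalley_eq0.
Qed.

Lemma is_weight_list c n : is_weight c n -> nonneg n -> n <> 0 ->
  coords n \in E6_pos.
Proof.
apply: pos_in_list => [m [x xm x0]|i m|i k k1 [x xk /eqP]].
- exact: root_space_sign xm x0.
- exact: is_weight_refl.
- by rewrite (root_space_multiple k1 xk).
Qed.

Lemma is_weight_theta c : (exists x : g, x != 0) -> is_weight c theta.
Proof.
by move=> gn0; apply: theta_in (is_weight_simple c _ gn0) => i m; apply: is_weight_refl.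
Qed.

(** A vector of positive weight takes a positive value on some coroot, so the
    corresponding [fv c i] cannot kill it, as a lowest weight vector takes
    nonpositive values.  Hence a nonzero one in the ideal gives another one of lower
    degree, and finally one in the Cartan subalgebra. *)
Lemma ideal_pos_eq0 c (I : {vspace g}) :
  (forall x y, y \in I -> lie x y \in I) ->
  (forall x, x \in I -> x \in cartan_subalg c -> x = 0) ->
  forall n x, root_space c (rt n) x -> nonneg n -> x \in I -> x = 0.
Proof.
move=> Iid Ih n x xn n0 xI.
have [N] := ubnP `|height n|%N; elim: N n x xn n0 xI => // N IH n x xn n0 xI hN.
have [nz|/eqP nn0] := eqVneq n 0.
  by apply: Ih => //; apply: root_space_zero; rewrite -nz.
have [i pi] := nonneg_pairing n0 nn0.
apply/eqP; apply: contraT => x0.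
have fx0 : lie (fv c i) x != 0.
  apply/eqP => fx.
  have xn' : root_space (chev_opp c) (rt (- n)) x.
    by rewrite root_space_oppE -raddfN opprK.
  have [m] := highest_string xn' x0 fx.
  by rewrite raddfN ffunE /=; lia.
have fxn : root_space c (rt (n - unit_at i)) (lie (fv c i) x).
  by rewrite addrC raddfD; apply: root_space_lie xn; apply: root_space_f.
have n'0 : nonneg (n - unit_at i).
  case: (root_space_sign fxn fx0) => // neg j.
  have pos : 0 < n i.
    rewrite lt_neqAle n0 andbT; apply/eqP => ni; apply: nn0; apply/ffunP => k.
    rewrite [RHS]ffunE; have [->//|ki] := eqVneq k i; apply/eqP.
    have := neg k; rewrite !ffunE (negPf ki) subr0 oppr_ge0 eq_le => ->.
    exact: n0.
  move: (neg j) (n0 j); rewrite !ffunE; case: eqP => [->|_] /=; lia.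
suff E : lie (fv c i) x = 0 by rewrite E eqxx in fx0.
apply: (IH (n - unit_at i)) => //; first exact: Iid.
have hE : height (n - unit_at i) = height n - 1.
  rewrite /height -(sum_mul_unit i (fun=> 1)) -sumrB.
  by apply: eq_bigr => j _; rewrite !ffunE mulr1.
by move: (height_ge0 n0) (height_ge0 n'0) hN; rewrite hE; lia.
Qed.

(** It suffices to treat weight vectors: a nonzero element of the ideal with the
    smallest number of basis components is one, because the adjoint action of
    the [hv c j] can otherwise be used to cancel some of the components. *)
Lemma ideal_eq0 c (I : {vspace g}) :
  (forall x y, y \in I -> lie x y \in I) ->
  (forall x, x \in I -> x \in cartan_subalg c -> x = 0) -> I = 0%VS.
Proof.
move=> Iid Ih; have hom n x : root_space c (rt n) x -> x \in I -> x = 0.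
  move=> xn xI; apply/eqP; apply: contraT => x0.
  case: (root_space_sign xn x0) => n0.
    by rewrite (ideal_pos_eq0 Iid Ih xn n0 xI) eqxx in x0.
  have xn' : root_space (chev_opp c) (rt (- n)) x.
    by rewrite root_space_oppE -raddfN opprK.
  rewrite (ideal_pos_eq0 (c := chev_opp c) Iid _ xn' n0 xI) ?eqxx // in x0.
  move=> y yI yh; apply: Ih => //; move: yh; apply: subvP.
  apply/span_subvP => _ /mapP[j _ ->] /=.
  by rewrite memvN hv_cartan.
apply/eqP; rewrite -subv0; apply/subvP => x xI; rewrite memv0.
have [b [n [bb bn]]] := graded_basis c.
pose supp x := [set k | coord b k x != 0]%SET.
have [N] := ubnP #|supp x|; elim: N x xI => // N IH x xI hN.
have [[k l] /= /and3P[kx lx kl]|H] :=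
  pickP (fun kl => [&& kl.1 \in supp x, kl.2 \in supp x & n kl.1 != n kl.2]).
  have [j nj] : exists j, rt (n k) j != rt (n l) j.
    apply/existsP; apply: contraNT kl; rewrite negb_exists => /forallP E.
    by apply/eqP/rt_inj/ffunP => j; apply/eqP; have := E j; rewrite negbK.
  pose y := lie (hv c j) x - (rt (n k) j)%:~R *: x.
  have yI : y \in I by rewrite rpredB ?memvZ ?Iid.
  have cy m : coord b m y = ((rt (n m) j)%:~R - (rt (n k) j)%:~R) * coord b m x.
    rewrite linearB linearZ /= mulrBl; congr (_ - _).
    rewrite {1}(coord_basis bb (memvf x)) lie_sumr.
    under eq_bigr => p do rewrite lieZr (graded_root_space (bn p)) scalerA.
    by rewrite coord_sum_free ?(basis_free bb) // mulrC.
  have y0 : y = 0.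
    apply/eqP; apply: IH => //.
    apply: leq_trans (hN : (#|supp x| <= N)%N).
    apply/proper_card/properP; split.
      apply/fintype.subsetP => m; rewrite !inE cy; apply: contraNneq => ->.
      by rewrite mulr0.
    by exists k => //; rewrite !inE cy subrr mul0r eqxx.
  move: (cy l); rewrite y0 linear0 => /esym/eqP.
  rewrite mulf_eq0 subr_eq0 eqr_int eq_sym (negPf nj) /=.
  by move: lx; rewrite inE => /negPf ->.
have [/existsP[k kx]|x0] := boolP [exists k, coord b k x != 0].
  apply/eqP; apply: (hom (n k)) => //.
  rewrite (coord_basis bb (memvf x)).
  apply: (big_ind (fun y => root_space c (rt (n k)) y)).
  - exact: root_space0.
  - by move=> y z hy hz; rewrite -[y]scale1r; apply: root_space_lin.
  - move=> l _; have [->|lx] := eqVneq (coord b l x) 0.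
      by rewrite scale0r; apply: root_space0.
    have := H (l, k); rewrite /= !inE kx lx /= => /negbFE/eqP <-.
    exact/root_spaceZ/graded_root_space.
rewrite (coord_basis bb (memvf x)) big1 // => k _.
move: x0; rewrite negb_exists => /forallP/(_ k); rewrite negbK => /eqP ->.
by rewrite scale0r.
Qed.

End Strings.

(** * Representations defined by matrices *)

(** Each product of three matrices occurs twice in the Jacobi identity for the
    commutator, with opposite signs. *)
Lemma jacobi_sum (V : zmodType) (a b c d e f : V) :
  a - b - (c - d) + (c - e - (f - b)) + (f - d - (a - e)) = 0.
Proof.
rewrite !opprB !addrA (ACl ((1*12)*(2*7)*(3*10)*(4*5)*(6*11)*(8*9)))%R /=.
by rewrite !subrr !addNr !addr0.
Qed.

Section GraphBracket.
Variables (K : fieldType) (g : finLieAlgType K) (d : nat).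
Implicit Types p q r : g * 'M[K]_d.

Definition commx (A B : 'M[K]_d) : 'M[K]_d := A *m B - B *m A.

Definition gbr p q := (lie p.1 q.1, commx p.2 q.2).

Lemma gbr_linearl k p q r : gbr (k *: p + q) r = k *: gbr p r + gbr q r.
Proof.
congr pair; first exact: lie_linearl.
by rewrite /commx /= mulmxDl mulmxDr -scalemxAl -scalemxAr opprD addrACA scalerBr.
Qed.

Lemma gbr_linearr k p q r : gbr p (k *: q + r) = k *: gbr p q + gbr p r.
Proof.
congr pair; first exact: lie_linearr.
by rewrite /commx /= mulmxDl mulmxDr -scalemxAl -scalemxAr opprD addrACA scalerBr.
Qed.

Lemma gbrxx p : gbr p p = 0.
Proof. by rewrite /gbr liexx /commx subrr. Qed.

Lemma gbr_jacobi p q r :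
  gbr p (gbr q r) + gbr q (gbr r p) + gbr r (gbr p q) = 0.
Proof.
congr pair; first exact: lie_jacobi.
by rewrite /= /commx !mulmxBl !mulmxBr !mulmxA jacobi_sum.
Qed.

Section Sub.
Variable V : {vspace g * 'M[K]_d}.
Hypothesis brV : forall p q, p \in V -> q \in V -> gbr p q \in V.

Let T := subvs_of V.
Let lieT (a b : T) : T := vsproj V (gbr (vsval a) (vsval b)).

Let lieTE a b : vsval (lieT a b) = gbr (vsval a) (vsval b).
Proof. by rewrite vsprojK // brV ?subvsP. Qed.

Let vsvalP k (a b : T) : vsval (k *: a + b) = k *: vsval a + vsval b.
Proof. by []. Qed.

Fact lieT_linearl (k : K) (x y z : T) : lieT (k *: x + y) z = k *: lieT x z + lieT y z.
Proof. by apply: subvs_inj; rewrite vsvalP !lieTE vsvalP gbr_linearl. Qed.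

Fact lieT_linearr (k : K) (x y z : T) : lieT x (k *: y + z) = k *: lieT x y + lieT x z.
Proof. by apply: subvs_inj; rewrite vsvalP !lieTE vsvalP gbr_linearr. Qed.

Fact lieTxx (x : T) : lieT x x = 0.
Proof. by apply: subvs_inj; rewrite lieTE gbrxx. Qed.

Fact lieT_jacobi (x y z : T) :
  lieT x (lieT y z) + lieT y (lieT z x) + lieT z (lieT x y) = 0.
Proof. by apply: subvs_inj; rewrite /= !lieTE gbr_jacobi. Qed.

(** The subalgebra becomes an algebra of its own, to which the theory of Chevalley
    generators can be applied. *)
Lemma sub_lie_algebra : exists (L : finLieAlgType K)
    (iota : {linear L -> (g * 'M[K]_d)%type}),
  [/\ injective iota, forall x, iota x \in V,
      forall p, p \in V -> exists x, p = iota x &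
      forall x y, iota (lie x y) = gbr (iota x) (iota y)].
Proof.
pose mix := Lmodule_isLie.Build K T lieT_linearl lieT_linearr lieTxx lieT_jacobi.
pose L : finLieAlgType K := HB.pack (subvs_of V) mix.
exists L, (vsval : {linear T -> _}); split=> [||p pV|].
- exact: subvs_inj.
- exact: subvsP.
- by exists (vsproj V p); apply/esym/vsprojK.
- exact: lieTE.
Qed.
End Sub.
End GraphBracket.

Lemma cartanP (K : numFieldType) (g : finLieAlgType K) (c : chevalley g) x :
  x \in cartan_subalg c -> exists a : 'I_6 -> K, x = \sum_i a i *: hv c i.
Proof.
rewrite /cartan_subalg span_def big_map big_enum => /memv_sumP[v vP ->].
have {}vP i : exists a, v i = a *: hv c i by apply/vlineP; apply: vP.
have [a aP] := choice vP; exists a.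
by apply: eq_bigr => i _; rewrite aP.
Qed.

(** The graph of the representation is the subalgebra of g x gl_d generated by the
    pairs (e_i, E_i) and (f_i, F_i), which has Chevalley generators again.  It
    projects onto [g].  The kernel of the projection is an ideal that meets the
    Cartan subalgebra trivially, since the Cartan matrix is invertible; so it is 0
    by [ideal_eq0]. *)
Theorem representation_of_matrices (K : numFieldType) (g : finLieAlgType K)
    (c : chevalley g) (d : nat) (E F H : 'I_6 -> 'M[K]_d) :
  (exists x : g, x != 0) ->
  (forall i j, commx (H i) (H j) = 0) ->
  (forall i j, commx (H i) (E j) = (cartan i j)%:~R *: E j) ->
  (forall i j, commx (H i) (F j) = - ((cartan i j)%:~R *: F j)) ->
  (forall i j, commx (E i) (F j) = if i == j then H i else 0) ->
  exists rho : g -> 'M[K]_d, [/\ linear rho,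
    forall x y, rho (lie x y) = commx (rho x) (rho y),
    forall i, rho (ev c i) = E i & forall i, rho (fv c i) = F i].
Proof.
move=> gn0 HH HE HF EF.
pose W : vectType K := (g * 'M[K]_d)%type.
pose subalg (V : {vspace W}) :=
  [/\ forall p q, p \in V -> q \in V -> gbr p q \in V,
      forall i, (ev c i, E i) \in V & forall i, (fv c i, F i) \in V].
(* a closed subspace of least dimension is generated by the pairs *)
have [V [brV VE VF] minV] : exists2 V, subalg V &
    forall V', subalg V' -> (\dim V <= \dim V')%N.
  have ex : exists m, `[< exists V, subalg V /\ \dim V = m >].
    exists (\dim {:W}); apply/asboolP; exists fullv; split=> //.
    by split=> *; rewrite memvf.
  have [m /asboolP[V [sV dV]] mP] := ex_minnP ex.
  exists V => // V' sV'; rewrite dV.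
  by apply: mP; apply/asboolP; exists V'.
have [L [iota [iota_inj iotaV Viota iota_lie]]] := sub_lie_algebra brV.
have [e' e'P] := choice (fun i => Viota _ (VE i)).
have [f' f'P] := choice (fun i => Viota _ (VF i)).
have Vh i : (hv c i, H i) \in V.
  by have := brV _ _ (VE i) (VF i); rewrite /gbr /= lie_ef EF eqxx.
have [h' h'P] := choice (fun i => Viota _ (Vh i)).
have hh i j : lie (h' i) (h' j) = 0.
  by apply: iota_inj; rewrite iota_lie -!h'P /gbr /= lie_hh HH linear0.
have he i j : lie (h' i) (e' j) = (cartan i j)%:~R *: e' j.
  by apply: iota_inj; rewrite linearZ iota_lie /= -!h'P -!e'P /gbr /= lie_he HE.
have hf i j : lie (h' i) (f' j) = - ((cartan i j)%:~R *: f' j).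
  by apply: iota_inj; rewrite linearN linearZ iota_lie /= -!h'P -!f'P /gbr /= lie_hf HF.
have ef i j : lie (e' i) (f' j) = if i == j then h' i else 0.
  apply: iota_inj; rewrite iota_lie -!e'P -!f'P /gbr /= lie_ef EF.
  by case: eqP => _; rewrite -?h'P ?linear0.
have iotaE (U : {vspace L}) x : (iota x \in linfun iota @: U)%VS = (x \in U).
  apply/memv_imgP/idP => [[y yU]|xU]; last by exists x; rewrite ?lfunE.
  by rewrite lfunE => /iota_inj ->.
have gen (U : {vspace L}) : (forall x y, x \in U -> y \in U -> lie x y \in U) ->
    (forall i, e' i \in U) -> (forall i, f' i \in U) -> U = fullv.
  move=> Ulie Ue Uf; pose V' := (linfun iota @: U)%VS.
  have V'V : (V' <= V)%VS.
    by apply/subvP => _ /memv_imgP[x xU ->]; rewrite lfunE iotaV.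
  have sV' : subalg V'.
    split=> [p q /memv_imgP[x xU ->] /memv_imgP[y yU ->]|i|i].
    - by rewrite !lfunE -iota_lie iotaE Ulie.
    - by rewrite e'P iotaE.
    - by rewrite f'P iotaE.
  have EV : V' = V by apply/eqP; rewrite eqEdim V'V minV.
  by apply/vspaceP => x; rewrite memvf -iotaE -/V' EV iotaV.
pose cL := Chevalley hh he hf ef gen.
pose p1 : {linear W -> g} := fst; pose p2 : {linear W -> 'M[K]_d} := snd.
pose pi1 := linfun (p1 \o iota); pose pi2 := linfun (p2 \o iota).
have pi1_lie x y : pi1 (lie x y) = lie (pi1 x) (pi1 y).
  by rewrite !lfunE /= iota_lie.
have pi2_lie x y : pi2 (lie x y) = commx (pi2 x) (pi2 y).
  by rewrite !lfunE /= iota_lie.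
have pi1e i : pi1 (e' i) = ev c i by rewrite lfunE /= -e'P.
have pi1f i : pi1 (f' i) = fv c i by rewrite lfunE /= -f'P.
have pi1h i : pi1 (h' i) = hv c i by rewrite lfunE /= -h'P.
have pi2e i : pi2 (e' i) = E i by rewrite lfunE /= -e'P.
have pi2f i : pi2 (f' i) = F i by rewrite lfunE /= -f'P.
have pi1_img : limg pi1 = fullv.
  apply: (chevalley_gen (c := c)) => [x y /memv_imgP[x' _ ->] /memv_imgP[y' _ ->]|i|i].
  - by rewrite -pi1_lie memv_img ?memvf.
  - by rewrite -pi1e memv_img ?memvf.
  - by rewrite -pi1f memv_img ?memvf.
have pi1_ker : lker pi1 = 0%VS.
  apply: (ideal_eq0 (c := cL)) => [x y|x]; rewrite !memv_ker.
    by move=> /eqP y0; rewrite pi1_lie y0 lie0r.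
  move=> /eqP x0 /cartanP[a xa].
  suff a0 k : a k = 0 by rewrite xa big1 // => k _; rewrite a0 scale0r.
  apply: cartan_left_injective k => j.
  have : lie (pi1 x) (ev c j) = 0 by rewrite x0 lie0l.
  rewrite xa linear_sum lie_suml.
  under eq_bigr => i _ do rewrite linearZ /= pi1h lieZl lie_he scalerA.
  rewrite -scaler_suml => /eqP; rewrite scaler_eq0 => /orP[/eqP //|/eqP ej0].
  by have [y y0] := gn0; rewrite (chevalley_eq0 ej0 y) eqxx in y0.
have lift x : exists y, pi1 y = x.
  by have := memvf x; rewrite -pi1_img => /memv_imgP[y _ ->]; exists y.
have [s sP] := choice lift.
have pi1_inj x y : pi1 x = pi1 y -> x = y.
  move=> E'; apply/eqP; rewrite -subr_eq0 -memv0 -pi1_ker memv_ker.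
  by rewrite linearB /= E' subrr.
exists (pi2 \o s); split=> [k x y|x y|i|i] /=.
- rewrite -[RHS]linearP; congr (pi2 _); apply: pi1_inj.
  by rewrite [RHS]linearP /= !sP.
- by rewrite -pi2_lie; congr (pi2 _); apply: pi1_inj; rewrite pi1_lie !sP.
- by rewrite -pi2e; congr (pi2 _); apply: pi1_inj; rewrite pi1e sP.
- by rewrite -pi2f; congr (pi2 _); apply: pi1_inj; rewrite pi1f sP.
Qed.

(** * The 27-dimensional representation *)

(** The weights of the minuscule module of highest weight omega_1: they are obtained
    from it by subtracting [alpha_i] when the value at [i] is 1. *)
Definition weights27 : seq (seq int) :=
  [:: [:: 1; 0; 0; 0; 0; 0]; [:: -1; 1; 0; 0; 0; 0]; [:: 0; -1; 1; 0; 0; 0];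
      [:: 0; 0; -1; 1; 0; 1]; [:: 0; 0; 0; -1; 1; 1]; [:: 0; 0; 0; 1; 0; -1];
      [:: 0; 0; 0; 0; -1; 1]; [:: 0; 0; 1; -1; 1; -1]; [:: 0; 0; 1; 0; -1; -1];
      [:: 0; 1; -1; 0; 1; 0]; [:: 0; 1; -1; 1; -1; 0]; [:: 1; -1; 0; 0; 1; 0];
      [:: 1; -1; 0; 1; -1; 0]; [:: 0; 1; 0; -1; 0; 0]; [:: -1; 0; 0; 0; 1; 0];
      [:: -1; 0; 0; 1; -1; 0]; [:: 1; -1; 1; -1; 0; 0]; [:: -1; 0; 1; -1; 0; 0];
      [:: 1; 0; -1; 0; 0; 1]; [:: -1; 1; -1; 0; 0; 1]; [:: 1; 0; 0; 0; 0; -1];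
      [:: 0; -1; 0; 0; 0; 1]; [:: -1; 1; 0; 0; 0; -1]; [:: 0; -1; 1; 0; 0; -1];
      [:: 0; 0; -1; 1; 0; 0]; [:: 0; 0; 0; -1; 1; 0]; [:: 0; 0; 0; 0; -1; 0]].

Definition zipw (f : int -> int -> int) (a b : seq int) :=
  [seq f ab.1 ab.2 | ab <- zip a b].

(** The generators permute the weight vectors up to vanishing, so they are given by
    maps on indices, where 27 (the value of [index] on an absent weight) stands for
    the zero vector.  The list [t] relabels the nodes. *)
Definition shift27 (f : int -> int -> int) (t : seq nat) (i q : nat) : nat :=
  index (zipw f (nth [::] weights27 q) (nth [::] cartan_rows (nth 0%N t i)))
    weights27.
Definition up27 := shift27 +%R.
Definition dn27 := shift27 (fun a b => a - b).

Definition wt27 (t : seq nat) (i q : nat) : int :=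
  nth 0 (nth [::] weights27 q) (nth 0%N t i).

Lemma shift27_out f t i q : (27 <= q)%N -> shift27 f t i q = 27%N.
Proof.
move=> hq; rewrite /shift27 [nth [::] weights27 q]nth_default //.
by rewrite /zipw; case: (nth _ cartan_rows _).
Qed.

(** The relations between the matrices of the relabelled generators, in a form
    decided by computation. *)
Definition relabel_ok (t : seq nat) : bool :=
  all (fun i => all (fun j => all (fun q =>
    let a := nth 0 (nth [::] cartan_rows i) j in
    let u := up27 t j q in let d := dn27 t j q in
    [&& (i == j) || (up27 t i d == dn27 t j (up27 t i q)),
        (27 <= u)%N || (wt27 t i u - wt27 t i q == a),
        (27 <= d)%N || (wt27 t i q - wt27 t i d == a) &
        all (fun p => (p == up27 t i (dn27 t i q))%:Z -
                      (p == dn27 t i (up27 t i q))%:Z ==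
                      if p == q then wt27 t i q else 0) (iota 0 27)])
    (iota 0 27)) (iota 0 6)) (iota 0 6).

Definition relabel_id : seq nat := [:: 0; 1; 2; 3; 4; 5]%N.
(** The symmetry of the diagram; it turns the highest weight into omega_5. *)
Definition relabel_flip : seq nat := [:: 4; 3; 2; 1; 0; 5]%N.

Lemma relabel_id_ok : relabel_ok relabel_id.
Proof. by vm_compute. Qed.
Lemma relabel_flip_ok : relabel_ok relabel_flip.
Proof. by vm_compute. Qed.

Lemma cartan_ord (i j : 'I_6) : cartan i j = nth 0 (nth [::] cartan_rows i) j.
Proof.
by move: i j; apply: nodeP; apply: nodeP; rewrite cartanE // /node !inordK.
Qed.

Section PartialMapMatrix.
Variables (K : numFieldType) (d : nat).
Implicit Types u v : nat -> nat.

(** The matrix of the map sending the [q]-th basis vector to the [u q]-th one,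
    or to 0 when [u q] is out of range. *)
Definition pmap_mx u : 'M[K]_d := \matrix_(p, q) ((p : nat) == u q)%:R.

Definition basis_col (q : nat) : 'cV[K]_d := \col_p ((p : nat) == q)%:R.

Lemma basis_col_out q : (d <= q)%N -> basis_col q = 0.
Proof.
move=> dq; apply/colP => p; rewrite !mxE.
by case: eqP (ltn_ord p) dq => // <-; lia.
Qed.

Lemma pmap_mx_col u q : (forall k, (d <= k)%N -> (d <= u k)%N) ->
  pmap_mx u *m basis_col q = basis_col (u q).
Proof.
move=> uout; have [dq|qd] := leqP d q.
  by rewrite !basis_col_out ?mulmx0 ?uout.
apply/colP => p; rewrite !mxE (bigD1 (Ordinal qd)) //= !mxE eqxx mulr1.
rewrite big1 ?addr0 // => k; rewrite !mxE -val_eqE /= => /negPf ->.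
by rewrite mulr0.
Qed.

Lemma pmap_mx_mul u v : (forall k, (d <= k)%N -> (d <= u k)%N) ->
  pmap_mx u *m pmap_mx v = pmap_mx (u \o v).
Proof.
move=> uout; apply/matrixP => p q.
have /colP/(_ p) := pmap_mx_col (v q) uout; rewrite !mxE /= => <-.
by apply: eq_bigr => k _; rewrite !mxE.
Qed.
End PartialMapMatrix.

Lemma mem_iota0 n (k : 'I_n) : (k : nat) \in iota 0 n.
Proof. by rewrite mem_iota /= add0n. Qed.

Lemma rep27 (K : numFieldType) (g : finLieAlgType K) (c : chevalley g) t :
  relabel_ok t -> (exists x : g, x != 0) ->
  exists rho : g -> 'M[K]_27, [/\ linear rho,
    forall x y, rho (lie x y) = commx (rho x) (rho y),
    forall i : 'I_6, rho (ev c i) = pmap_mx K 27 (up27 t i),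
    forall i : 'I_6, rho (fv c i) = pmap_mx K 27 (dn27 t i) &
    forall (i : 'I_6) q, (q < 27)%N -> rho (hv c i) *m basis_col K 27 q =
      (wt27 t i q)%:~R *: basis_col K 27 q].
Proof.
move=> tok gn0.
have upo i k : (27 <= k)%N -> (27 <= up27 t i k)%N.
  by move=> hk; rewrite /up27 shift27_out.
have dno i k : (27 <= k)%N -> (27 <= dn27 t i k)%N.
  by move=> hk; rewrite /dn27 shift27_out.
pose w (i : 'I_6) : 'rV[K]_27 := \row_q (wt27 t i q)%:~R.
have tokE (i j : 'I_6) (q : 'I_27) : [&& ((i : nat) == j) ||
      (up27 t i (dn27 t j q) == dn27 t j (up27 t i q)),
      (27 <= up27 t j q)%N || (wt27 t i (up27 t j q) - wt27 t i q ==
                              nth 0 (nth [::] cartan_rows i) j),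
      (27 <= dn27 t j q)%N || (wt27 t i q - wt27 t i (dn27 t j q) ==
                              nth 0 (nth [::] cartan_rows i) j) &
      all (fun p => (p == up27 t i (dn27 t i q))%:Z -
                    (p == dn27 t i (up27 t i q))%:Z ==
                    if p == q then wt27 t i q else 0) (iota 0 27)] :=
  allP (allP (allP tok _ (mem_iota0 i)) _ (mem_iota0 j)) _ (mem_iota0 q).
have HH i j : commx (diag_mx (w i)) (diag_mx (w j)) = 0.
  apply/eqP; rewrite /commx !mulmx_diag subr_eq0; apply/eqP.
  by congr diag_mx; apply/rowP => q; rewrite !mxE mulrC.
have HE (i j : 'I_6) : commx (diag_mx (w i)) (pmap_mx K 27 (up27 t j)) =
    (cartan i j)%:~R *: pmap_mx K 27 (up27 t j).
  apply/matrixP => p q.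
  rewrite /commx mul_diag_mx mul_mx_diag !mxE; case: eqP => [Ep|_]; last first.
    by rewrite !(mulr0, mul0r) ?(subrr, oppr0).
  have [_ /orP[qu|/eqP E] _ _] := and4P (tokE i j q).
    by move: qu; rewrite -Ep leqNgt ltn_ord.
  by rewrite cartan_ord -E -Ep mulr1n mulr1 mul1r intrB mulr1.
have HF (i j : 'I_6) : commx (diag_mx (w i)) (pmap_mx K 27 (dn27 t j)) =
    - ((cartan i j)%:~R *: pmap_mx K 27 (dn27 t j)).
  apply/matrixP => p q.
  rewrite /commx mul_diag_mx mul_mx_diag !mxE; case: eqP => [Ep|_]; last first.
    by rewrite !(mulr0, mul0r) ?(subrr, oppr0).
  have [_ _ /orP[qu|/eqP E] _] := and4P (tokE i j q).
    by move: qu; rewrite -Ep leqNgt ltn_ord.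
  by rewrite cartan_ord -E -Ep mulr1n mulr1 mul1r intrB mulr1 opprB.
have EF (i j : 'I_6) : commx (pmap_mx K 27 (up27 t i)) (pmap_mx K 27 (dn27 t j)) =
    if i == j then diag_mx (w i) else 0.
  rewrite /commx !pmap_mx_mul; do ?[exact: upo|exact: dno].
  have [ij|ij] := eqVneq i j; apply/matrixP => p q; rewrite !mxE /=.
    have [_ _ _ /allP/(_ _ (mem_iota0 p))/eqP] := and4P (tokE i j q).
    rewrite -ij => /(congr1 (fun z : int => z%:~R : K)).
    have cast_sub (b1 b2 : bool) : (b1%:Z - b2%:Z)%:~R = b1%:R - b2%:R :> K.
      by rewrite intrB.
    rewrite cast_sub => ->; have [->|pq] := eqVneq p q.
      by rewrite eqxx; move: (wt27 t i q) => z; rewrite mulr1n.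
    rewrite -val_eqE /= in pq; rewrite (negPf pq).
    by move: (wt27 t i p) => z; rewrite mulr0n.
  have [/orP[ij'|/eqP ->] _ _ _] := and4P (tokE i j q); last by rewrite subrr.
  by rewrite (inj_eq val_inj) (negPf ij) in ij'.
have [rho [lrho rho_lie rhoe rhof]] :=
  @representation_of_matrices K g c 27 _ _ (fun i => diag_mx (w i)) gn0 HH HE HF EF.
exists rho; split=> // i q hq.
have -> : rho (hv c i) = diag_mx (w i).
  by have := lie_ef c i i; rewrite eqxx => <-; rewrite rho_lie rhoe rhof EF eqxx.
apply/colP => p; rewrite mul_diag_mx !mxE.
by case: eqP => [->|_]; rewrite ?mulr0 // mulr1.
Qed.

(** * Root vectors killing the generator of M(m omega_i) *)

Lemma lie_tpow (K : fieldType) (g : lieAlgType K) (x y : g) r s :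
  lie (tpow x r : current g) (tpow y s) = tpow (lie x y) (r + s).
Proof.
apply: currentP => n; rewrite [LHS]clieE /=.
have [En|nrs] := eqVneq n (r + s)%N; last first.
  rewrite big1 // => i _; rewrite big1 // => j /eqP ij.
  have [ir|] := eqVneq (i : nat) r; last by rewrite lie0l.
  have [js|] := eqVneq (j : nat) s; last by rewrite lie0r.
  by move: nrs; rewrite -ij ir js eqxx.
have hr : (r < n.+1)%N by lia. have hs : (s < n.+1)%N by lia.
rewrite (bigD1 (Ordinal hr)) //= [X in _ + X]big1 ?addr0 => [|i ir]; last first.
  rewrite big1 // => j _; case: eqP => [E|_]; last by rewrite lie0l.
  by move: ir; rewrite -val_eqE /= E eqxx.
rewrite (big_pred1 (Ordinal hs)) ?eqxx //= => j.
transitivity ((j : nat) == s); last by [].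
by rewrite [X in _ == X]En eqn_add2l.
Qed.

Section LeftIdeal.
Variables (K : numFieldType) (g : finLieAlgType K) (c : chevalley g).
Variables (i : 'I_6) (m : nat).
Local Notation J := (kills c i m).

Lemma kills_sub a b : J a -> J b -> J (a - b).
Proof.
by move=> Ja Jb; apply: left_ideal_add => //; rewrite -mulN1r; apply: left_ideal_mul.
Qed.

Lemma kills_lie (u v : gcur g) : J (uin u) -> J (uin v) -> J (uin (lie u v)).
Proof.
by move=> Ju Jv; rewrite uin_lie; apply: kills_sub; apply: left_ideal_mul.
Qed.

Lemma kills_ut_lie x y r s : J (ut x r) -> J (ut y s) -> J (ut (lie x y) (r + s)).
Proof. by move=> Jx Jy; rewrite /ut -lie_tpow; apply: kills_lie. Qed.

Lemma utP k x y r : ut (k *: x + y) r = k *: ut x r + ut y r :> U (gcur g).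
Proof.
rewrite /ut -linearP; congr uin; apply: currentP => n.
by rewrite ccoefD ccoefZ /=; case: eqP; rewrite ?scaler0 ?addr0.
Qed.

Lemma kills_lin k x y r : J (ut x r) -> J (ut y r) -> J (ut (k *: x + y) r).
Proof.
move=> Jx Jy; rewrite utP; apply: left_ideal_add => //.
by rewrite -[ut x r]mul1r scalerAl; apply: left_ideal_mul.
Qed.

Lemma kills_ut0 r : J (ut 0 r).
Proof.
rewrite /ut; have -> : tpow 0 r = 0 :> gcur g.
  by apply: currentP => n /=; rewrite if_same.
by rewrite linear0; apply: left_ideal_0.
Qed.

Lemma kills_f0 j : (m == 0)%N || (j != i) -> J (ut (fv c j) 0).
Proof.
move=> mj; apply: left_ideal_gen; have [ji|ji] := eqVneq j i.
  move: mj; rewrite ji eqxx orbF => /eqP m0.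
  by left; right; rewrite m0 expr1.
by left; left; left; right; exists j.
Qed.

Lemma kills_h1 j : J (ut (hv c j) 1).
Proof.
apply: left_ideal_gen; do 5!left; right; exists (tpow (hv c j) 1 : gcur g) => //.
split=> // r /=; case: eqP => _; [exact: hv_cartan|exact: mem0v].
Qed.

(** f_j t is a multiple of the bracket of h_j t and f_j. *)
Lemma kills_f1 j : J (ut (fv c j) 1).
Proof.
have [->|ji] := eqVneq j i; first by apply: left_ideal_gen; right.
have J0 : J (ut (fv c j) 0) by apply: kills_f0; rewrite ji orbT.
have := kills_ut_lie (kills_h1 j) J0; rewrite lie_hf addn0 cartan_diag => J1.
have -> : fv c j = (- 2%:R^-1) *: (- (2%:~R *: fv c j)) + 0.
  by rewrite addr0 scaleNr scalerN opprK scalerA mulVf ?scale1r ?pnatr_eq0.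
exact/kills_lin/kills_ut0.
Qed.

Local Notation fbr := (ebr (chev_opp c)).

Lemma content_cons_at l w j : content (l :: w) j i = (l == i)%:Z + content w j i.
Proof. by rewrite content_cons ffunE ffunE eq_sym. Qed.

Lemma kills_fbr0 w j : (m == 0)%N || (content w j i == 0) -> J (ut (fbr w j) 0).
Proof.
elim: w => [|l w IH] H.
  apply: kills_f0; case/orP: H => [->//|].
  rewrite /content big_nil addr0 ffunE [i == j]eq_sym => H.
  by apply/orP; right; move: H; case: (j == i).
have c0 := content_ge0 w j i; apply: (@kills_ut_lie _ _ 0 0).
  apply: kills_f0; case/orP: H => [->//|]; rewrite content_cons_at => H.
  by apply/orP; right; move: H; case: (l == i) => /=; lia.
apply: IH; case/orP: H => [->//|]; rewrite content_cons_at => H.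
by apply/orP; right; move: H; case: (l == i) => /=; lia.
Qed.

Lemma kills_fbr1 w j : (m == 0)%N || (content w j i <= 1) -> J (ut (fbr w j) 1).
Proof.
elim: w => [|l w IH] H; first exact: kills_f1.
have c0 := content_ge0 w j i.
have [li|] := boolP ((m == 0)%N || (l != i)).
  apply: (@kills_ut_lie _ _ 0 1); first exact: kills_f0.
  apply: IH; case/orP: H => [->//|]; rewrite content_cons_at => H.
  by apply/orP; right; move: H; case: (l == i) => /=; lia.
rewrite negb_or negbK => /andP[m0 /eqP li].
apply: (@kills_ut_lie _ _ 1 0); first exact: kills_f1.
apply: kills_fbr0; move: H; rewrite (negPf m0) content_cons_at li eqxx /=.
by lia.
Qed.

(** The generator of M(m omega_i) is killed by all f_j t, and by f_j if j is not i
    or m = 0.  If m = 0, or if a bracket of the f_j contains f_i at most once, the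
    factor t can be moved so that all entries kill the generator. *)
Lemma kills_root_vector n x : nonneg n -> n <> 0 -> (m == 0)%N || (n i <= 1) ->
  root_space c (- rt n) x -> J (ut x 1).
Proof.
move=> n0 nn0 mn; rewrite -root_space_oppE; move: x.
apply: (@root_space_pos_ind _ _ (chev_opp c) n (fun x => J (ut x 1)) _ _ _ n0 nn0).
- exact: kills_ut0.
- by move=> k x y; apply: kills_lin.
- by move=> w j E; apply: kills_fbr1; rewrite E.
Qed.

End LeftIdeal.

(** * Modules of the current algebra *)

Section LinearProp.
Variables (K : fieldType) (V W : lmodType K) (A : V -> W).
Hypothesis linA : linear A.
Lemma linear_prop0 : A 0 = 0.
Proof. by have := linA (-1) 0 0; rewrite scaleN1r addNr scaleN1r addNr. Qed.
Lemma linear_propD x y : A (x + y) = A x + A y.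
Proof. by rewrite -[x in LHS]scale1r linA scale1r. Qed.
Lemma linear_propZ k x : A (k *: x) = k *: A x.
Proof. by rewrite -[_ *: _]addr0 linA linear_prop0 addr0. Qed.
Lemma linear_propN x : A (- x) = - A x.
Proof. by rewrite -scaleN1r linear_propZ scaleN1r. Qed.
End LinearProp.

Section EnvelopingMatrix.
Variables (K : fieldType) (L : lieAlgType K) (d : nat) (phi : L -> 'M[K]_d).
Hypothesis phi_lin : linear phi.
Hypothesis phi_lie : forall x y, phi (lie x y) = commx (phi x) (phi y).

Lemma enveloping_rep : exists psi : U L -> 'M[K]_d,
  [/\ forall a b, psi (a + b) = psi a + psi b, forall a b, psi (a * b) = psi a *m psi b,
      psi 1 = 1%:M & forall x, psi (uin x) = phi x].
Proof.
case: d phi phi_lin phi_lie => [|n] f flin flie.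
  by exists (fun=> 0); split=> *; apply/matrixP => -[].
pose F : {linear L -> 'M[K]_n.+1} :=
  HB.pack f (GRing.isLinear.Build K L 'M[K]_n.+1 _ f flin).
have [psi psiP] := @U_lift K L _ F flie.
by exists psi; split=> *; rewrite ?rmorphD ?rmorphM ?rmorph1 ?psiP.
Qed.

End EnvelopingMatrix.

(** A matrix representation of g[t] on which t^2 acts by zero: [A x] and [B x] are
    the actions of [x] and [x t]. *)
Record trep (K : fieldType) (g : lieAlgType K) (d : nat) (A B : g -> 'M[K]_d) : Prop :=
  Trep {
    trep_linA : linear A;
    trep_linB : linear B;
    trep_AA : forall x y, A (lie x y) = commx (A x) (A y);
    trep_AB : forall x y, B (lie x y) = commx (A x) (B y);
    trep_BB : forall x y, commx (B x) (B y) = 0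
  }.

(** [v] satisfies the defining relations of the generator of M(m omega_i); the
    condition on n+ without t is stated for the generators [ev c j] only. *)
Record highest (K : numFieldType) (g : finLieAlgType K) (c : chevalley g)
    (i : 'I_6) (m d p : nat) (A B : g -> 'M[K]_d) (v : 'M[K]_(d, p)) : Prop :=
  Highest {
    highest_e : forall j, A (ev c j) *m v = 0;
    highest_eB : forall n x, nonneg n -> n <> 0 -> root_space c (rt n) x -> B x *m v = 0;
    highest_hB : forall x, x \in cartan_subalg c -> B x *m v = 0;
    highest_h : forall j, j != i -> A (hv c j) *m v = 0;
    highest_f : forall j, j != i -> A (fv c j) *m v = 0;
    highest_hi : A (hv c i) *m v = m%:R *: v;
    highest_fi : iter m.+1 (mulmx (A (fv c i))) v = 0;
    highest_fB : B (fv c i) *m v = 0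
  }.

Section CommX.
Variables (K : fieldType) (d : nat).
Implicit Types A B C : 'M[K]_d.
Lemma commxDl A B C : commx (A + B) C = commx A C + commx B C.
Proof. by rewrite /commx mulmxDl mulmxDr opprD addrACA. Qed.
Lemma commxDr A B C : commx A (B + C) = commx A B + commx A C.
Proof. by rewrite /commx mulmxDl mulmxDr opprD addrACA. Qed.
Lemma commxC A B : commx A B = - commx B A.
Proof. by rewrite /commx opprB. Qed.
End CommX.

Section Annihilation.
Variables (K : numFieldType) (g : finLieAlgType K) (c : chevalley g).

Lemma trep_current d (A B : g -> 'M[K]_d) : trep A B ->
  let phi (u : gcur g) := A (ccoef u 0) + B (ccoef u 1) in
  linear phi /\ forall u v, phi (lie u v) = commx (phi u) (phi v).
Proof.
case=> lA lB AA AB BB phi; split=> [k u v|u v].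
  by rewrite /phi !ccoefD !ccoefZ lA lB scalerDr addrACA.
rewrite /phi /= big_ord1 !big_ord_recl big_ord0 addr0 /= /bump /= !addn0 !subn0 subnn.
rewrite commxDl !commxDr BB addr0 AA (linear_propD lB) AB [lie (u 1%N) _]lieC.
by rewrite (linear_propN lB) AB -commxC addrA.
Qed.

(** The universal property of M(m omega_i): its generator can be sent to any vector
    that satisfies the relations. *)
Lemma kills_annihilates i m d p (A B : g -> 'M[K]_d) (v : 'M[K]_(d, p)) x :
  trep A B -> highest c i m A B v -> kills c i m (ut x 1) -> B x *m v = 0.
Proof.
move=> tAB hvec; have [phi_lin phi_lie] := trep_current tAB.
have [lA lB AA AB BB] := tAB; have [he heB hhB hh hf hhi hfi hfB] := hvec.
have [psi [psiD psiM psi1 psiE]] := enveloping_rep phi_lin phi_lie.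
have heA n y : nonneg n -> n <> 0 -> root_space c (rt n) y -> A y *m v = 0.
  move=> n0 nn0; move: y.
  apply: (@root_space_pos_ind _ _ c n (fun y => A y *m v = 0) _ _ _ n0 nn0).
  - by rewrite (linear_prop0 lA) mul0mx.
  - by move=> k y z Ay Az; rewrite lA mulmxDl -scalemxAl Ay Az scaler0 addr0.
  - move=> w j _; elim: w => [|l w IH] /=; first exact: he.
    by rewrite AA /commx mulmxBl -!mulmxA he IH !mulmx0 subrr.
have nplus0 (C : g -> 'M[K]_d) y : linear C ->
    (forall n y, nonneg n -> n <> 0 -> root_space c (rt n) y -> C y *m v = 0) ->
    nplus c y -> C y *m v = 0.
  move=> lC CP [s sP ->]; elim: s sP => [|z s IH] sP.
    by rewrite big_nil (linear_prop0 lC) mul0mx.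
  rewrite big_cons (linear_propD lC) mulmxDl IH => [|y' y's]; last first.
    by apply: sP; rewrite inE y's orbT.
  rewrite addr0; have [al [al0 [n En] _] zal] := sP z (mem_head _ _).
  apply: (CP [ffun j => (n j)%:Z]) => [j|E|]; first by rewrite ffunE.
    by move: al0; rewrite En rt_sum E raddf0 eqxx.
  by rewrite -rt_sum -En.
have ut0E y : psi (ut y 0) = A y.
  by rewrite psiE /= (linear_prop0 lB) addr0.
have ut1E y : psi (ut y 1) = B y.
  by rewrite psiE /= (linear_prop0 lA) add0r.
have psi_0 : psi 0 = 0.
  have := psiD 0 0; rewrite addr0.
  by move/(congr1 (fun z => z - psi 0)); rewrite addrK subrr.
have psi_nat (n : nat) : psi n%:R = n%:R%:M.
  elim: n => [|n IH]; first by rewrite !mulr0n psi_0 raddf0.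
  by rewrite -!natr1 psiD IH psi1 raddfD.
have psiN a : psi (- a) = - psi a.
  by apply/eqP; rewrite -addr_eq0 -psiD addNr psi_0.
have psi0 a : kills c i m a -> psi a *m v = 0.
  elim=> {a} [a||a b _ Ha _ Hb|a b _ Hb].
  - case=> [[[[[[|]|]|]|]|]|].
    + by move=> [u uP ->]; rewrite psiE mulmxDl !nplus0 ?addr0.
    + move=> [u [u0 uP] ->].
      by rewrite psiE u0 (linear_prop0 lA) add0r hhB.
    + by move=> [j ji ->]; rewrite ut0E hh.
    + by move=> [j ji ->]; rewrite ut0E hf.
    + move=> ->; rewrite psiD psiN psi_nat ut0E mulmxDl mulNmx hhi.
      by rewrite mul_scalar_mx subrr.
    + move=> ->; rewrite -[RHS]hfi; elim: m.+1 => [|n IH].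
        by rewrite expr0 psi1 mul1mx.
      by rewrite exprS psiM -mulmxA IH iterS ut0E.
    + by move=> ->; rewrite ut1E.
  - by rewrite psi_0 mul0mx.
  - by rewrite psiD mulmxDl Ha Hb addr0.
  - by rewrite psiM -mulmxA Hb mulmx0.
by move/psi0; rewrite ut1E.
Qed.

End Annihilation.

Section Tensor.
Variable K : fieldType.

Lemma tensmxDl m n p q (A A' : 'M[K]_(m, n)) (B : 'M[K]_(p, q)) :
  (A + A') *t B = A *t B + A' *t B.
Proof. by apply/matrixP => i j; rewrite !mxE mulrDl. Qed.
Lemma tensmxDr m n p q (A : 'M[K]_(m, n)) (B B' : 'M[K]_(p, q)) :
  A *t (B + B') = A *t B + A *t B'.
Proof. by apply/matrixP => i j; rewrite !mxE mulrDr. Qed.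
Lemma tensmxZl m n p q k (A : 'M[K]_(m, n)) (B : 'M[K]_(p, q)) :
  (k *: A) *t B = k *: (A *t B).
Proof. by apply/matrixP => i j; rewrite !mxE mulrA. Qed.
Lemma tensmxZr m n p q k (A : 'M[K]_(m, n)) (B : 'M[K]_(p, q)) :
  A *t (k *: B) = k *: (A *t B).
Proof. by apply/matrixP => i j; rewrite !mxE mulrCA. Qed.
Lemma tensmxNl m n p q (A : 'M[K]_(m, n)) (B : 'M[K]_(p, q)) :
  (- A) *t B = - (A *t B).
Proof. by rewrite -!scaleN1r tensmxZl. Qed.
Lemma tensmxNr m n p q (A : 'M[K]_(m, n)) (B : 'M[K]_(p, q)) :
  A *t (- B) = - (A *t B).
Proof. by rewrite -!scaleN1r tensmxZr. Qed.

Lemma tensmx_neq0 m n p q (A : 'M[K]_(m, n)) (B : 'M[K]_(p, q)) :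
  A != 0 -> B != 0 -> A *t B != 0.
Proof.
move=> /matrix0Pn[i [j Aij]] /matrix0Pn[k [l Bkl]].
apply/matrix0Pn; exists (mxtens_index (i, k)), (mxtens_index (j, l)).
by rewrite tensmxE mulf_neq0.
Qed.

Definition tens_act m n (A : 'M[K]_m) (B : 'M[K]_n) : 'M[K]_(m * n) :=
  A *t 1%:M + 1%:M *t B.

Lemma tens_actE m n p q (A : 'M[K]_m) (B : 'M[K]_n) (v : 'M[K]_(m, p))
    (w : 'M[K]_(n, q)) :
  tens_act A B *m (v *t w) = (A *m v) *t w + v *t (B *m w).
Proof. by rewrite mulmxDl !tensmx_mul !mul1mx. Qed.

Lemma tens_act_comm m n (A A' : 'M[K]_m) (B B' : 'M[K]_n) :
  commx (tens_act A B) (tens_act A' B') = tens_act (commx A A') (commx B B').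
Proof.
rewrite /tens_act commxDl !commxDr /commx !tensmx_mul !mul1mx !mulmx1.
rewrite !subrr addr0 add0r.
by rewrite tensmxDl tensmxDr tensmxNl tensmxNr.
Qed.

(** In the expansion of the power m + m' + 1 each term has more than m factors on
    the left or more than m' on the right. *)
Lemma tens_act_iter_eq0 d d' p p' (X : 'M[K]_d) (Y : 'M[K]_d') (v : 'M[K]_(d, p))
    (w : 'M[K]_(d', p')) m m' :
  iter m.+1 (mulmx X) v = 0 -> iter m'.+1 (mulmx Y) w = 0 ->
  iter (m + m').+1 (mulmx (tens_act X Y)) (v *t w) = 0.
Proof.
move=> Xv Yw.
have itr0 n (q : nat) (Z : 'M[K]_n) k : iter k (mulmx Z) (0 : 'M_(n, q)) = 0.
  by elim: k => //= k ->; rewrite mulmx0.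
have itrD n (q : nat) (Z : 'M[K]_n) k (u u' : 'M_(n, q)) :
  iter k (mulmx Z) (u + u') = iter k (mulmx Z) u + iter k (mulmx Z) u'.
  by elim: k => //= k ->; rewrite mulmxDr.
have itr_large n (q : nat) (Z : 'M[K]_n) (u : 'M_(n, q)) k l :
    iter k.+1 (mulmx Z) u = 0 -> (k < l)%N -> iter l (mulmx Z) u = 0.
  by move=> Zu kl; rewrite -(subnK kl) iterD Zu itr0.
suff H k a b : (m + m' < k + a + b)%N -> iter k (mulmx (tens_act X Y))
    (iter a (mulmx X) v *t iter b (mulmx Y) w) = 0.
  by apply: (H _ 0 0)%N; rewrite !addn0.
elim: k a b => [|k IH] a b hk.
  have [ha|ha] := ltnP m a; first by rewrite (itr_large _ _ _ _ _ _ Xv ha) tens0mx.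
  have hb : (m' < b)%N by lia.
  by rewrite (itr_large _ _ _ _ _ _ Yw hb) tensmx0.
by rewrite iterSr tens_actE itrD -!iterS !IH ?addr0 //; lia.
Qed.

End Tensor.

Section TensorPower.
Variables (K : numFieldType) (g : finLieAlgType K) (c : chevalley g).

Lemma trep_eval d (A B : g -> 'M[K]_d) : trep A B -> trep A (fun=> 0).
Proof.
case=> lA _ AA _ _; split=> // [k x y|x y|x y].
- by rewrite scaler0 addr0.
- by rewrite /commx mulmx0 mul0mx subrr.
- by rewrite /commx mulmx0 subrr.
Qed.

Lemma trep_tensor d d' (A B : g -> 'M[K]_d) (A' : g -> 'M[K]_d') :
  trep A B -> trep A' (fun=> 0) ->
  trep (fun x => tens_act (A x) (A' x)) (fun x => B x *t 1%:M).
Proof.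
case=> lA lB AA AB BB [lA' _ AA' _ _]; split.
- move=> k x y; rewrite /tens_act lA lA' tensmxDl tensmxDr tensmxZl tensmxZr.
  by rewrite scalerDr addrACA.
- by move=> k x y; rewrite lB tensmxDl tensmxZl.
- by move=> x y; rewrite tens_act_comm AA AA'.
- move=> x y; rewrite AB /tens_act commxDl.
  rewrite {2 3}/commx !tensmx_mul !mul1mx !mulmx1 subrr addr0.
  by rewrite /commx tensmxDl tensmxNl.
- move=> x y; have /eqP := BB x y; rewrite /commx !tensmx_mul subr_eq0 => /eqP ->.
  by rewrite subrr.
Qed.

Lemma highest_eval i m d p (A B : g -> 'M[K]_d) (v : 'M[K]_(d, p)) :
  highest c i m A B v -> highest c i m A (fun=> 0) v.
Proof. by case=> *; split=> // *; rewrite mul0mx. Qed.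

Lemma highest_tensor i m m' d d' p p' (A B : g -> 'M[K]_d) (A' : g -> 'M[K]_d')
    (v : 'M[K]_(d, p)) (v' : 'M[K]_(d', p')) :
  highest c i m A B v -> highest c i m' A' (fun=> 0) v' ->
  highest c i (m + m') (fun x => tens_act (A x) (A' x)) (fun x => B x *t 1%:M) (v *t v').
Proof.
case=> he heB hhB hh hf hhi hfi hfB [he' _ _ hh' hf' hhi' hfi' _].
split=> [j|n x n0 nn0 xn|x xh|j ji|j ji|||].
- by rewrite tens_actE he he' tens0mx tensmx0 addr0.
- by rewrite tensmx_mul (heB n) // tens0mx.
- by rewrite tensmx_mul hhB // tens0mx.
- by rewrite tens_actE hh // hh' // tens0mx tensmx0 addr0.
- by rewrite tens_actE hf // hf' // tens0mx tensmx0 addr0.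
- by rewrite tens_actE hhi hhi' tensmxZl tensmxZr -scalerDl natrD.
- exact: tens_act_iter_eq0.
- by rewrite tensmx_mul hfB tens0mx.
Qed.

(** The case m = 1 implies the others: tensor with m - 1 copies of the module on
    which t is made to act by zero. *)
Lemma highest_neq0_nokill i m d p (A B : g -> 'M[K]_d) (v : 'M[K]_(d, p)) x :
  trep A B -> highest c i 1 A B v -> B x *m v != 0 -> (0 < m)%N ->
  ~ kills c i m (ut x 1).
Proof.
move=> tAB hAB Bxv; case: m => // m _.
have v0 : v != 0 by apply: contraNneq Bxv => ->; rewrite mulmx0.
suff [d' [p' [A' [B' [v' [tAB' hAB' /eqP nz]]]]]] : exists d' p' (A' B' : g -> 'M[K]_d')
    (v' : 'M[K]_(d', p')), [/\ trep A' B', highest c i m.+1 A' B' v' & B' x *m v' != 0].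
  by move/(kills_annihilates tAB' hAB').
elim: m => [|m [d' [p' [A' [B' [v' [tAB' hAB' nz]]]]]]]; first by exists d, p, A, B, v.
exists (d' * d)%N, (p' * p)%N, (fun x => tens_act (A' x) (A x)),
  (fun x => B' x *t 1%:M), (v' *t v); split.
- exact: trep_tensor (trep_eval tAB).
- by rewrite -addn1; apply: highest_tensor (highest_eval hAB).
- by rewrite tensmx_mul mul1mx tensmx_neq0.
Qed.
End TensorPower.

(** * The Killing form *)

Section Killing.
Variables (K : numFieldType) (g : finLieAlgType K).
Implicit Types x y z : g.
Local Notation D := (\dim {:g}).
Local Notation vb := (vbasis {:g}).

Definition coord_col y : 'cV[K]_D := \col_p coord vb p y.
Definition ad_mx x : 'M[K]_D := \matrix_(p, q) coord vb p (lie x vb`_q).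

Lemma ad_mx_linear : linear ad_mx.
Proof.
by move=> k x y; apply/matrixP => p q; rewrite !mxE lie_linearl linearP.
Qed.

Lemma ad_mx_col x y : ad_mx x *m coord_col y = coord_col (lie x y).
Proof.
apply/colP => p; rewrite !mxE [in RHS](coord_vbasis (memvf y)) lie_sumr linear_sum.
by apply: eq_bigr => q _; rewrite !mxE lieZr linearZ mulrC.
Qed.

Lemma ad_mx_mul x y :
  ad_mx x *m ad_mx y = \matrix_(p, q) coord vb p (lie x (lie y vb`_q)).
Proof.
apply/matrixP => p q; rewrite [RHS]mxE.
have /colP/(_ p) := ad_mx_col x (lie y vb`_q); rewrite [RHS]mxE => <-.
by rewrite !mxE; apply: eq_bigr => k _; rewrite !mxE.
Qed.

Lemma ad_mx_lie x y : ad_mx (lie x y) = commx (ad_mx x) (ad_mx y).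
Proof.
rewrite /commx !ad_mx_mul; apply/matrixP => p q; rewrite !mxE -linearB.
by rewrite [lie x (lie y _)]lie_deriv addrK.
Qed.

Lemma killingE x y : killing x y = \tr (ad_mx x *m ad_mx y).
Proof. by rewrite ad_mx_mul; apply: eq_bigr => p _; rewrite !mxE. Qed.

Lemma killingC x y : killing x y = killing y x.
Proof. by rewrite !killingE mxtrace_mulC. Qed.

Lemma killing_linearr x k y z : killing x (k *: y + z) = k * killing x y + killing x z.
Proof. by rewrite !killingE ad_mx_linear mulmxDr -scalemxAr linearP. Qed.

Lemma killing_linearl x y z k : killing (k *: x + y) z = k * killing x z + killing y z.
Proof. by rewrite ![killing _ z]killingC killing_linearr. Qed.

Lemma killing_lie x y z : killing (lie x y) z = killing x (lie y z).
Proof.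
rewrite !killingE !ad_mx_lie /commx mulmxBl mulmxBr !linearB /= !mulmxA.
by congr (_ - _); rewrite mxtrace_mulC !mulmxA mxtrace_mulC !mulmxA mxtrace_mulC mulmxA.
Qed.

Lemma killing0l y : killing 0 y = 0.
Proof. by have := killing_linearl 0 0 y (-1); rewrite scaleN1r addNr mulN1r addNr. Qed.

Lemma killing0r y : killing y 0 = 0.
Proof. by rewrite killingC killing0l. Qed.

Lemma killingZl k x y : killing (k *: x) y = k * killing x y.
Proof. by rewrite -[k *: x]addr0 killing_linearl killing0l addr0. Qed.

Lemma killingZr k x y : killing x (k *: y) = k * killing x y.
Proof. by rewrite killingC killingZl killingC. Qed.

Lemma killingDr x y z : killing x (y + z) = killing x y + killing x z.
Proof. by rewrite -[y]scale1r killing_linearr mul1r scale1r. Qed.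

Lemma killing_sumr (I : Type) (s : seq I) (F : I -> g) x :
  killing x (\sum_(k <- s) F k) = \sum_(k <- s) killing x (F k).
Proof. exact: (big_morph (killing x) (killingDr x) (killing0r x)). Qed.

Lemma killing_orthogonal (c : chevalley g) a b x y :
  root_space c a x -> root_space c b y -> a + b <> 0 -> killing x y = 0.
Proof.
move=> xa yb ab0; apply/eqP; apply: contraT => xy; case: ab0; apply/ffunP => i.
have := killing_lie x (hv c i) y; rewrite lieC xa yb -scaleNr killingZl killingZr.
move/(mulIf xy)/eqP; rewrite eq_sym -addr_eq0 addrC -intrD intr_eq0 => /eqP.
by rewrite !ffunE.
Qed.

(** The radical of the form is an ideal. *)
Lemma killing_nondegenerate x : simple_lie g -> (exists y z : g, killing y z != 0) ->
  x != 0 -> exists y, killing y x != 0.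
Proof.
move=> [_ simple] [y0 [z0 yz0]] x0.
have [rad radP] : exists V : {vspace g}, forall x, x \in V <-> forall y, killing y x = 0.
  apply: vspace_of_linear_set => [y|k y z yR zR t]; first exact: killing0r.
  by rewrite killing_linearr yR zR mulr0 addr0.
have rad_ideal y z : z \in rad -> lie y z \in rad.
  by move=> /radP zR; apply/radP => t; rewrite -killing_lie zR.
have [rad0|radT] := simple rad rad_ideal; last first.
  have /radP zR : z0 \in rad by rewrite radT memvf.
  by rewrite zR eqxx in yz0.
have [//|H] := pselect (exists y, killing y x != 0).
case/negP: x0; rewrite -memv0 -rad0; apply/radP => y; apply/eqP.
by apply: contraT => yx; case: H; exists y.
Qed.

(** The trace is computed in a basis of eigenvectors. *)
Lemma killing_eigenbasis x (b : D.-tuple g) (a : 'I_D -> K) : basis_of fullv b ->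
  (forall k : 'I_D, lie x b`_k = a k *: b`_k) -> killing x x = \sum_k a k ^+ 2.
Proof.
move=> bb xb; pose P : 'M[K]_D := \matrix_(p, k) coord vb p b`_k.
pose Q : 'M[K]_D := \matrix_(k, p) coord b k vb`_p.
have PQ : P *m Q = 1%:M.
  apply/matrixP => p q; rewrite !mxE.
  have := coord_basis bb (memvf vb`_q) => /(congr1 (coord vb p)).
  rewrite linear_sum (coord_free _ _ (basis_free (vbasisP _))) => E.
  transitivity ((q == p)%:R : K); last by rewrite eq_sym.
  by rewrite E; apply: eq_bigr => k _; rewrite !mxE linearZ mulrC.
have xP : ad_mx x *m P = P *m diag_mx (\row_k a k).
  apply/matrixP => p k; rewrite mul_mx_diag !mxE.
  have /colP/(_ p) := ad_mx_col x b`_k; rewrite xb !mxE linearZ /= mulrC => <-.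
  by apply: eq_bigr => q _; rewrite !mxE.
have xE : ad_mx x = P *m diag_mx (\row_k a k) *m Q.
  by rewrite -xP -mulmxA PQ mulmx1.
rewrite killingE {2}xE !mulmxA xP mxtrace_mulC !mulmxA (mulmx1C PQ) mul1mx.
by rewrite mulmx_diag /mxtrace; apply: eq_bigr => k _; rewrite !mxE eqxx expr2.
Qed.

End Killing.

Section KillingCartan.
Variables (K : numFieldType) (g : finLieAlgType K) (c : chevalley g).
Hypothesis gn0 : exists x : g, x != 0.

(** By invariance kappa(h_i, h_j) is a_ij kappa(e_i, f_i), and symmetry makes
    kappa(e_i, f_i) equal for adjacent nodes.  The constant is positive since
    kappa(h_i, h_i) is the sum of the squares of the eigenvalues of h_i, which are
    integers. *)
Lemma killing_hv : exists2 k : K, 0 < k & forall i j,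
  killing (hv c i) (hv c j) = k * (cartan i j)%:~R.
Proof.
pose t i := killing (ev c i) (fv c i).
have hht i j : killing (hv c i) (hv c j) = (cartan i j)%:~R * t i.
  have := lie_ef c i i; rewrite eqxx => <-.
  by rewrite killing_lie lieC lie_hf opprK killingZr cartanC.
have tE i j : cartan i j = -1 -> t i = t j.
  move=> aij; have := killingC (hv c i) (hv c j).
  by rewrite !hht [cartan j i]cartanC aij !mulN1r => /oppr_inj.
have t3 : forall i, t i = t (node 3).
  have t23 : t (node 2) = t (node 3) by apply: tE; rewrite cartanE.
  have t43 : t (node 4) = t (node 3) by apply: tE; rewrite cartanE.
  apply: nodeP => //.
  - by rewrite -t23; apply: tE; rewrite cartanE.
  - by rewrite -t43; apply: tE; rewrite cartanE.
  - by apply: tE; rewrite cartanE.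
exists (t (node 3)) => [|i j]; last by rewrite hht t3 mulrC.
have [b [n [bb bn]]] := graded_basis c.
have := killing_eigenbasis (x := hv c (node 3)) bb
  (fun k => graded_root_space (bn k) (node 3)).
rewrite hht cartan_diag => E.
suff : 0 < 2%:~R * t (node 3) by rewrite pmulr_rgt0 // ltr0z.
rewrite E lt_def sumr_ge0 ?andbT; last first.
  by move=> k _; rewrite -rmorphXn ler0z sqr_ge0.
rewrite psumr_neq0; last by move=> k _; rewrite -rmorphXn ler0z sqr_ge0.
have e0 : ev c (node 3) != 0.
  have [x] := gn0; apply: contra_neqN => /eqP/chevalley_eq0. exact.
have : lie (hv c (node 3)) (ev c (node 3)) != 0.
  by rewrite lie_he cartan_diag scaler_eq0 (negPf e0) intr_eq0.
apply: contraNT => /hasPn H.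
rewrite [ev _ _](coord_basis bb (memvf _)) lie_sumr big1 // => k _.
rewrite lieZr (graded_root_space (bn k) (node 3)).
have := H k (mem_index_enum _); rewrite /= lt_def -rmorphXn ler0z sqr_ge0 andbT negbK.
by rewrite intr_eq0 expf_eq0 => /andP[_ /eqP ->]; rewrite scale0r scaler0.
Qed.

(** The Gram matrix is [k] times the Cartan matrix, which is also the matrix of
    [rt]. *)
Lemma wform_rt : exists2 k : K, 0 < k & forall n nu : weight,
  wform c (rt n) nu = k * (\sum_i n i * nu i)%:~R.
Proof.
have [k k0 kP] := killing_hv; exists k^-1; first by rewrite invr_gt0.
move=> n nu; have k_neq0 : k != 0 by rewrite gt_eqF.
pose G := killing_gram c.
have GE : G = k *: \matrix_(i, j) (cartan i j)%:~R.
  by apply/matrixP => i j; rewrite !mxE kP.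
have Gunit : G \in unitmx.
  pose B : 'M[K]_6 := (3%:R * k)^-1 *: \matrix_(i, j) (cartan_adj i j)%:~R.
  suff GB : G *m B = 1%:M by have [] := mulmx1_unit GB.
  rewrite GE -scalemxAl -scalemxAr scalerA; apply/matrixP => i j; rewrite !mxE.
  under eq_bigr do rewrite !mxE -intrM.
  rewrite -rmorph_sum cartan_adjP; case: eqP => _ /=; last by rewrite mulr0n mulr0.
  rewrite mulr1n mulrAC -[3%:~R]/(3%:R : K) [k * 3%:R]mulrC mulfV //.
  by rewrite mulf_neq0 ?pnatr_eq0.
have rE : weight_row K (rt n) = (k^-1 *: weight_row K n) *m G.
  rewrite GE -scalemxAl -scalemxAr scalerA mulVf // scale1r.
  apply/rowP => j; rewrite !mxE ffunE rmorph_sum.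
  by apply: eq_bigr => i _; rewrite /= !mxE intrM mulrC cartanC.
rewrite /wform -/G rE mulmxK // -scalemxAl mxE; congr (_ * _).
rewrite mxE rmorph_sum; apply: eq_bigr => i _.
by rewrite /= !mxE intrM.
Qed.
End KillingCartan.

(** * The highest weight vector of a chain *)

Section KillingExtension.
Variables (K : numFieldType) (g : finLieAlgType K).
Implicit Types x y z : g.
Local Notation D := (\dim {:g}).
Local Notation vb := (vbasis {:g}).

Definition killing_row x : 'rV[K]_D := \row_q killing x vb`_q.

Lemma killing_row_col x y : killing_row x *m coord_col y = (killing x y)%:M.
Proof.
apply/matrixP => p q; rewrite !ord1 [RHS]mxE eqxx mulr1n mxE.
rewrite [in RHS](coord_vbasis (memvf y)) killing_sumr.
by apply: eq_bigr => k _; rewrite !mxE killingZr mulrC.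
Qed.

Definition ext_ad x : 'M[K]_(D + 1) := block_mx (ad_mx x) 0 0 0.
Definition ext_killing x : 'M[K]_(D + 1) := block_mx 0 0 (killing_row x) 0.
Definition ext_col y : 'cV[K]_(D + 1) := col_mx (coord_col y) 0.
Definition ext_top : 'cV[K]_(D + 1) := col_mx 0 1%:M.

Lemma ext_col0 : ext_col 0 = 0.
Proof.
by apply/eqP; rewrite col_mx_eq0 eqxx andbT; apply/eqP/colP => p; rewrite !mxE linear0.
Qed.

Lemma ext_colZ k y : ext_col (k *: y) = k *: ext_col y.
Proof.
rewrite /ext_col scale_col_mx scaler0; congr col_mx.
by apply/colP => p; rewrite !mxE linearZ.
Qed.

Lemma ext_ad_col x y : ext_ad x *m ext_col y = ext_col (lie x y).
Proof. by rewrite mul_block_col !mul0mx !addr0 ad_mx_col. Qed.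

Lemma ext_killing_col x y : ext_killing x *m ext_col y = killing x y *: ext_top.
Proof.
rewrite mul_block_col !mul0mx !addr0 killing_row_col.
by rewrite /ext_top scale_col_mx scaler0 scalemx1.
Qed.

Lemma ext_top_neq0 : ext_top != 0.
Proof. by rewrite col_mx_eq0 negb_and oner_eq0 orbT. Qed.

(** The module g + C, where [x t] maps [y] in g to the scalar kappa(x, y); it
    satisfies the relation between [ext_ad] and [ext_killing] because the Killing
    form is invariant. *)
Lemma trep_ext : trep ext_ad ext_killing.
Proof.
split=> [k x y|k x y|x y|x y|x y].
- by rewrite /ext_ad scale_block_mx add_block_mx !scaler0 !addr0 ad_mx_linear.
- rewrite /ext_killing scale_block_mx add_block_mx !scaler0 !addr0; congr block_mx.
  by apply/rowP => q; rewrite !mxE killing_linearl.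
- rewrite /ext_ad /commx !mulmx_block !(mul0mx, mulmx0, addr0) ad_mx_lie.
  by rewrite opp_block_mx add_block_mx !subr0.
- rewrite /ext_ad /ext_killing /commx !mulmx_block !(mul0mx, mulmx0, addr0, add0r).
  rewrite opp_block_mx add_block_mx !subr0 add0r; congr block_mx.
  apply/rowP => q; rewrite [LHS]mxE lieC -scaleN1r killingZl mulN1r killing_lie [RHS]mxE.
  have /matrixP/(_ 0 0) := killing_row_col y (lie x vb`_q).
  rewrite [RHS]mxE eqxx mulr1n => <-; congr (- _); rewrite !mxE.
  by apply: eq_bigr => p _; rewrite !mxE.
- by rewrite /ext_killing /commx !mulmx_block !(mul0mx, mulmx0, addr0) subrr.
Qed.
End KillingExtension.

Lemma telescope (K : pzRingType) (V : lmodType K) r (T : nat -> V) :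
  \sum_(k < r.+1) (-1) ^+ k *:
    ((if (k < r)%N then T k.+1 else 0) + (if (0 < k)%N then T k else 0)) = 0.
Proof.
under eq_bigr do rewrite scalerDr.
rewrite big_split /= big_ord_recr /= ltnn scaler0 addr0.
rewrite [X in _ + X]big_ord_recl /= scaler0 add0r -big_split big1 //= => k _.
by rewrite ltn_ord exprS mulN1r scaleNr addrN.
Qed.

(** Root vectors [x k] and weight vectors [w k] such that, at the node [s k.+1],
    [x k] is raised to [x k.+1] while [w k.+1] is raised to [w k].  In
    the alternating sum of the tensors of [x k] and [w k] the two kinds of
    contributions of a raising operator cancel, and likewise for the lowering
    operators at nodes other than [i]. *)
Section Chain.
Variables (K : numFieldType) (g : finLieAlgType K) (c : chevalley g).
Variables (i : 'I_6) (d r : nat) (rho : g -> 'M[K]_d).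
Variables (s : nat -> 'I_6) (n : nat -> weight) (x : nat -> g) (w : nat -> 'cV[K]_d).
Hypothesis rho_rep : trep rho (fun=> 0).
Hypothesis x_e : forall j k, (k <= r)%N ->
  lie (ev c j) (x k) = if (k < r)%N && (j == s k.+1) then x k.+1 else 0.
Hypothesis w_e : forall j k, (k <= r)%N ->
  rho (ev c j) *m w k = if (0 < k)%N && (j == s k) then w k.-1 else 0.
Hypothesis x_f : forall j k, j != i -> (k <= r)%N ->
  lie (fv c j) (x k) = if (0 < k)%N && (j == s k) then x k.-1 else 0.
Hypothesis w_f : forall j k, j != i -> (k <= r)%N ->
  rho (fv c j) *m w k = if (k < r)%N && (j == s k.+1) then w k.+1 else 0.
Hypothesis x_root : forall k, (k <= r)%N ->
  [/\ root_space c (rt (n k)) (x k), nonneg (n k), n k <> 0 & n k <> unit_at i].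
Hypothesis w_h : forall j k, (k <= r)%N ->
  rho (hv c j) *m w k = ((j == i)%:Z - rt (n k) j)%:~R *: w k.
Hypothesis fi_fi : forall k, (k <= r)%N ->
  [/\ lie (fv c i) (lie (fv c i) (x k)) = 0, rho (fv c i) *m (rho (fv c i) *m w k) = 0 &
      lie (fv c i) (x k) = 0 \/ rho (fv c i) *m w k = 0].

Let A y := tens_act (ext_ad y) (rho y).
Let B y : 'M[K]_((\dim {:g} + 1) * d) := ext_killing y *t 1%:M.
Definition chain_vector := \sum_(k < r.+1) (-1) ^+ k *: (ext_col (x k) *t w k).

Let actA y : A y *m chain_vector = \sum_(k < r.+1) (-1) ^+ k *:
  (ext_col (lie y (x k)) *t w k + ext_col (x k) *t (rho y *m w k)).
Proof.
rewrite /chain_vector mulmx_sumr; apply: eq_bigr => k _.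
by rewrite -scalemxAr /A tens_actE ext_ad_col.
Qed.

Lemma chain_killing y : B y *m chain_vector =
  \sum_(k < r.+1) (-1) ^+ k *: (killing y (x k) *: (ext_top g *t w k)).
Proof.
rewrite /chain_vector mulmx_sumr; apply: eq_bigr => k _.
by rewrite -scalemxAr tensmx_mul mul1mx ext_killing_col tensmxZl.
Qed.

Let chain_killing0 a y : root_space c (rt a) y ->
  (forall k, (k <= r)%N -> a + n k <> 0) -> B y *m chain_vector = 0.
Proof.
move=> ya an0; rewrite chain_killing big1 // => k _.
have kr : (k <= r)%N by rewrite -ltnS.
have [xk _ _ _] := x_root kr.
rewrite (killing_orthogonal ya xk) ?scale0r ?scaler0 // -raddfD => /eqP.
by rewrite -(raddf0 rt) => /eqP/rt_inj; apply: an0.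
Qed.

Lemma chain_highest : highest c i 1 A B chain_vector.
Proof.
have leS (k : 'I_r.+1) : (k <= r)%N by rewrite -ltnS.
split=> [j|a y a0 an0 ya|y yh|j ji|j ji||/=|].
- pose T k := if j == s k then ext_col (x k) *t w k.-1 else 0.
  rewrite actA -[RHS](telescope r T); apply: eq_bigr => k _.
  rewrite x_e // w_e // /T; congr (_ *: (_ + _)).
    by case: (k < r)%N => //=; case: (j == _); rewrite ?ext_col0 ?tens0mx.
  by case: (0 < k)%N => //=; case: (j == _); rewrite ?tensmx0.
- apply: (chain_killing0 ya) => k kr E; apply: an0; have [_ nk0 _ _] := x_root kr.
  apply/ffunP => l; rewrite [RHS]ffunE; apply/eqP; rewrite eq_le a0 andbT.
  by move/ffunP/(_ l): E (nk0 l); rewrite ffunE [RHS]ffunE => /eqP;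
    rewrite addr_eq0 => /eqP ->; rewrite oppr_le0.
- have [a ->] := cartanP yh.
  suff H (t : g) : root_space c (rt 0) t -> B t *m chain_vector = 0.
    apply: H; apply: (big_ind (fun t => root_space c (rt 0) t)) => [|u v hu hvec|k _].
    + exact: root_space0.
    + by rewrite -[u]scale1r; apply: root_space_lin.
    + exact/root_spaceZ/root_space_h.
  by move=> t0; apply: (chain_killing0 t0) => k kr; rewrite add0r; have [] := x_root kr.
- rewrite actA big1 // => k _; have [xk _ _ _] := x_root (leS k).
  rewrite xk w_h // ext_colZ tensmxZl tensmxZr -scalerDl -intrD (negPf ji).
  by rewrite add0r subrr scale0r scaler0.
- pose T k := if j == s k then ext_col (x k.-1) *t w k else 0.
  rewrite actA -[RHS](telescope r T); apply: eq_bigr => k _.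
  rewrite x_f // w_f // /T [RHS]scalerDr [LHS]scalerDr addrC; congr (_ *: _ + _ *: _).
    by case: (k < r)%N => //=; case: (j == _); rewrite ?tensmx0.
  by case: (0 < k)%N => //=; case: (j == _); rewrite ?ext_col0 ?tens0mx.
- rewrite actA scale1r; apply: eq_bigr => k _; have [xk _ _ _] := x_root (leS k).
  rewrite xk w_h // ext_colZ tensmxZl tensmxZr -scalerDl -intrD eqxx.
  by rewrite addrC subrK scale1r.
- rewrite actA mulmx_sumr big1 // => k _.
  rewrite -scalemxAr mulmxDr /A !tens_actE !ext_ad_col.
  have [-> ->] := fi_fi (leS k).
  by case=> ->; rewrite ?lie0r ?mulmx0 ?ext_col0 ?tens0mx ?tensmx0 !addr0 scaler0.
- apply: (chain_killing0 (root_space_f c i)) => k kr; rewrite addrC => /eqP.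
  by rewrite subr_eq0 => /eqP; have [] := x_root kr.
Qed.

(** A root vector [y] with opposite weight to [x k] and nonzero pairing with it
    exists by nondegeneracy; [y t] maps the chain vector to a multiple of
    the top vector tensored with [w k]. *)
Lemma chain_nokill k : simple_lie g -> (exists z : g, z != 0) -> (k <= r)%N ->
  (forall l, (l <= r)%N -> n l = n k -> l = k) -> x k != 0 -> w k != 0 ->
  exists2 y, root_space c (- rt (n k)) y & forall m, (0 < m)%N -> ~ kills c i m (ut y 1).
Proof.
move=> simple_g gn0 kr nk xk0 wk0; have [xk _ _ _] := x_root kr.
have [y ya yx] : exists2 y, root_space c (- rt (n k)) y & killing y (x k) != 0.
  have [k1 k1_gt0 kP] := killing_hv c gn0.
  have [|y yx] := killing_nondegenerate simple_g _ xk0.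
    exists (hv c i), (hv c i); rewrite kP cartan_diag mulf_neq0 ?intr_eq0 //.
    by rewrite gt_eqF.
  have [b [a [bb ba]]] := graded_basis c.
  have [l yl] : exists l : 'I_(\dim {:g}), killing b`_l (x k) != 0.
    apply/existsP; apply: contraNT yx; rewrite negb_exists => /forallP H.
    rewrite killingC (coord_basis bb (memvf y)).
    rewrite killing_sumr big1 // => l _.
    by have := H l; rewrite negbK killingZr killingC => /eqP ->; rewrite mulr0.
  exists b`_l => //; have bl := graded_root_space (ba l).
  suff <- : rt (a l) = - rt (n k) by [].
  apply/eqP; rewrite -addr_eq0; apply: contraNT yl => /eqP H.
  by rewrite (killing_orthogonal bl xk).
exists y => // m m0; apply: (highest_neq0_nokill _ chain_highest) => //.
  exact: trep_tensor (trep_ext g) rho_rep.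
have kr' : (k < r.+1)%N by [].
rewrite chain_killing (bigD1 (Ordinal kr')) //= big1 ?addr0 => [|l lk].
  rewrite !scaler_eq0 signr_eq0 (negPf yx) /=.
  exact: tensmx_neq0 (ext_top_neq0 g) wk0.
have lr : (l <= r)%N by rewrite -ltnS.
have [xl _ _ _] := x_root lr.
rewrite (killing_orthogonal ya xl) ?scale0r ?scaler0 // => /eqP.
rewrite addrC subr_eq0 => /eqP/rt_inj/(nk _ lr) E.
by rewrite -val_eqE /= E eqxx in lk.
Qed.
End Chain.

(** * Chains of roots ending at the highest root *)

Definition of_coords (r : seq int) : weight := [ffun i : 'I_6 => nth 0 r i].

Lemma of_coords_node r k : (0 < k <= 6)%N -> of_coords r (node k) = nth 0 r k.-1.
Proof. by move=> hk; rewrite ffunE /node inordK; last lia. Qed.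

Lemma of_coordsK r : size r = 6 -> coords (of_coords r) = r.
Proof.
rewrite /coords !of_coords_node //.
by case: r => [|? [|? [|? [|? [|? [|? [|? r]]]]]]].
Qed.

Lemma coordsK n : of_coords (coords n) = n.
Proof. by apply: coords_inj; rewrite of_coordsK. Qed.

Lemma E6_pos_size r : r \in E6_pos -> size r = 6.
Proof.
by move=> rE; apply/eqP; move: r rE; apply/allP.
Qed.

(** Moving by a multiple of a simple root, on lists of coordinates. *)
Definition ladd (r : seq int) (k : nat) (a : int) : seq int :=
  set_nth 0 r k.-1 (nth 0 r k.-1 + a).

Lemma coords_ladd n k a : (0 < k <= 6)%N ->
  coords (n + unit_at (node k) *~ a) = ladd (coords n) k a.
Proof.
move=> hk; have E j : (n + unit_at (node k) *~ a) j = n j + a * (j == node k)%:Z.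
  by rewrite ffunE ffunMzE ffunE -mulrzl intz.
rewrite /coords !E !node_eq // /ladd.
by case: k hk {E} => [|[|[|[|[|[|[|k]]]]]]] //= _; rewrite !(mulr0, mulr1, addr0).
Qed.

Section Chains.
Variables (K : numFieldType) (g : finLieAlgType K) (c : chevalley g).

(** A positive entry rules out negative roots and 0. *)
Definition no_root (r : seq int) : bool := has (fun a => 0 < a) r && (r \notin E6_pos).

Lemma root_space_no_root n x : no_root (coords n) -> root_space c (rt n) x -> x = 0.
Proof.
move=> /andP[pos nr] xn; apply/eqP; apply: contraT => x0.
have {pos} [k pk] : exists i, 0 < n i.
  by case/hasP: pos => a; rewrite /coords !inE;
    do 5?[case/predU1P => [->|]; first by eexists; eassumption];
    move=> /eqP ->; exists (node 6).
case: (root_space_sign xn x0) => n0.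
  case/negP: nr; apply: (@is_weight_list _ _ c) => //; first by exists x.
  by move=> E; rewrite E ffunE ltxx in pk.
by have := n0 k; rewrite ffunE oppr_ge0 leNgt pk.
Qed.

(** The facts on the 36 roots that the construction of a chain relies on.  [ds] lists
    the roots of the chain; for k > 0 the k-th entry of [ss] is the node by which
    the root with index k exceeds the previous one, and its entry 0 is a dummy
    node. *)
Definition chain_ok (i : nat) (ss : seq nat) (ds : seq (seq int)) : bool :=
  let r := (size ds).-1 in
  [&& last [::] ds == [:: 1; 2; 3; 2; 1; 2], uniq ds, (0 < size ds)%N,
      all (fun j => (0 < j <= 6)%N) ss, size ss == size ds, (0 < i <= 6)%N &
  all (fun k => let d := nth [::] ds k in
    [&& d \in E6_pos, all (fun a => 0 <= a) d, d != nth [::] E6_pos i.-1,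
        no_root (ladd d i (-2)) &
    all (fun j =>
      (if (k < r)%N && (j == nth 0%N ss k.+1) then
        [&& ladd d j 1 == nth [::] ds k.+1, lrt j (nth [::] ds k.+1) == 1 &
            no_root (ladd (nth [::] ds k.+1) j 1)]
       else no_root (ladd d j 1)) &&
      ((0 < k)%N && (j == nth 0%N ss k) || (j == i) || no_root (ladd d j (-1))))
    (iota 1 6)]) (iota 0 (size ds))].

Definition chain_nodes2 := [:: 1; 5; 4; 3; 6]%N.
Definition chain_roots2 : seq (seq int) :=
  [:: [:: 1; 2; 2; 1; 0; 1]; [:: 1; 2; 2; 1; 1; 1]; [:: 1; 2; 2; 2; 1; 1];
      [:: 1; 2; 3; 2; 1; 1]; [:: 1; 2; 3; 2; 1; 2]].
Definition chain_nodes4 := [:: 1; 1; 2; 3; 6]%N.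
Definition chain_roots4 : seq (seq int) :=
  [:: [:: 0; 1; 2; 2; 1; 1]; [:: 1; 1; 2; 2; 1; 1]; [:: 1; 2; 2; 2; 1; 1];
      [:: 1; 2; 3; 2; 1; 1]; [:: 1; 2; 3; 2; 1; 2]].
Definition chain_nodes6 := [:: 1]%N.
Definition chain_roots6 : seq (seq int) := [:: [:: 1; 2; 3; 2; 1; 2]].

Lemma chain_ok2 : chain_ok 2 chain_nodes2 chain_roots2. Proof. by vm_compute. Qed.
Lemma chain_ok4 : chain_ok 4 chain_nodes4 chain_roots4. Proof. by vm_compute. Qed.
Lemma chain_ok6 : chain_ok 6 chain_nodes6 chain_roots6. Proof. by vm_compute. Qed.

Section ChainVectors.
Variables (i : nat) (ss : seq nat) (ds : seq (seq int)).
Hypothesis ok : chain_ok i ss ds.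
Local Notation r := (size ds).-1.
Let s k := node (nth 0%N ss k).
Let n k := of_coords (nth [::] ds k).

Let size_ds : (0 < size ds)%N. Proof. by case/and5P: ok => _ _ -> _ _. Qed.
Let i16 : (0 < i <= 6)%N. Proof. by case/and5P: ok => _ _ _ _ /and3P[]. Qed.

Let ok_k k : (k <= r)%N -> let d := nth [::] ds k in
    [&& d \in E6_pos, all (fun a => 0 <= a) d, d != nth [::] E6_pos i.-1,
        no_root (ladd d i (-2)) &
    all (fun j =>
      (if (k < r)%N && (j == nth 0%N ss k.+1) then
        [&& ladd d j 1 == nth [::] ds k.+1, lrt j (nth [::] ds k.+1) == 1 &
            no_root (ladd (nth [::] ds k.+1) j 1)]
       else no_root (ladd d j 1)) &&
      ((0 < k)%N && (j == nth 0%N ss k) || (j == i) || no_root (ladd d j (-1))))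
    (iota 1 6)].
Proof.
move=> kr; have /and5P[_ _ _ _ /and3P[_ _ /allP]] := ok; apply.
by rewrite mem_iota /=; lia.
Qed.

Let ss16 k : (k <= r)%N -> (0 < nth 0%N ss k <= 6)%N.
Proof.
move=> kr; have /and5P[_ _ _ /allP ssP /and3P[/eqP sz _ _]] := ok.
by apply/ssP/mem_nth; rewrite sz; lia.
Qed.

Let ncoords k : (k <= r)%N -> coords (n k) = nth [::] ds k.
Proof. by move=> /ok_k/and5P[dE _ _ _ _]; rewrite of_coordsK ?E6_pos_size. Qed.

Let in_nodes j : (0 < j <= 6)%N -> j \in iota 1 6.
Proof. by rewrite mem_iota; lia. Qed.

Let up_ok k j : (k <= r)%N -> (0 < j <= 6)%N ->
  ~~ ((k < r)%N && (node j == s k.+1)) -> no_root (coords (n k + unit_at (node j))).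
Proof.
move=> kr hj; rewrite -[unit_at _]mulr1z coords_ladd // ncoords //.
have /and5P[_ _ _ _ /allP/(_ _ (in_nodes hj))/andP[+ _]] := ok_k kr.
case: ifP => // /andP[kr' /eqP ->]; by rewrite kr' eqxx.
Qed.

Let step_ok k : (k < r)%N ->
  [/\ n k.+1 = n k + unit_at (s k.+1), rt (n k.+1) (s k.+1) = 1 &
  no_root (coords (n k.+1 + unit_at (s k.+1)))].
Proof.
move=> kr; have hj := ss16 kr.
have /and5P[_ _ _ _ /allP/(_ _ (in_nodes hj))/andP[+ _]] := ok_k (ltnW kr).
rewrite kr eqxx /= => /and3P[/eqP E /eqP rt1 nr]; split.
- by apply: coords_inj; rewrite -[unit_at _]mulr1z coords_ladd // !ncoords // ltnW.
- by rewrite rt_coords // ncoords.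
- by rewrite -[unit_at _]mulr1z coords_ladd // ncoords.
Qed.

Let down_ok k j : (k <= r)%N -> (0 < j <= 6)%N -> node j != node i ->
  ~~ ((0 < k)%N && (node j == s k)) -> no_root (coords (n k - unit_at (node j))).
Proof.
move=> kr hj ji jk; rewrite -mulrN1z coords_ladd // ncoords //.
have /and5P[_ _ _ _ /allP/(_ _ (in_nodes hj))/andP[_ +]] := ok_k kr.
rewrite -!orbA => /or3P[/andP[k0 /eqP jE]|/eqP jE|//].
  by move: jk; rewrite k0 /s jE eqxx.
by rewrite jE eqxx in ji.
Qed.

(** The vectors are obtained by lowering a highest root vector; raising goes back,
    because the root with index k + 1 takes the value 1 on the coroot and cannot be
    raised at that node. *)
Lemma chain_root_vectors z : root_space c (rt theta) z -> z != 0 ->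
  exists x : nat -> g,
  [/\ forall j k, (k <= r)%N ->
        lie (ev c j) (x k) = if (k < r)%N && (j == s k.+1) then x k.+1 else 0,
      forall j k, j != node i -> (k <= r)%N ->
        lie (fv c j) (x k) = if (0 < k)%N && (j == s k) then x k.-1 else 0,
      forall k, (k <= r)%N -> [/\ root_space c (rt (n k)) (x k), nonneg (n k),
        n k <> 0 & n k <> unit_at (node i)],
      forall k, (k <= r)%N -> lie (fv c (node i)) (lie (fv c (node i)) (x k)) = 0 &
      forall k, (k <= r)%N -> x k != 0].
Proof.
move=> zt z0.
pose x k := foldr (fun l => lie (fv c (s l))) z (iota k.+1 (r - k)).
have x_step k : (k < r)%N -> x k = lie (fv c (s k.+1)) (x k.+1).
  by move=> kr; rewrite /x -{1}(subnSK kr).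
have xr : x r = z by rewrite /x subnn.
have nr_theta : n r = theta.
  apply: coords_inj; rewrite ncoords // nth_last coords_theta.
  by case/and5P: ok => /eqP ->.
have descend (P : nat -> Prop) : P r -> (forall k, (k < r)%N -> P k.+1 -> P k) ->
    forall k, (k <= r)%N -> P k.
  move=> Pr Ps k kr; rewrite -(subKn kr).
  elim: (r - k)%N => [|m IH]; first by rewrite subn0.
  have [mr|mr] := ltnP m r; last by rewrite (_ : (r - m.+1 = r - m)%N) //; lia.
  by apply: Ps; [lia|rewrite (_ : (r - m.+1).+1 = r - m)%N //; lia].
have x_root k : (k <= r)%N -> root_space c (rt (n k)) (x k).
  move: k; apply: descend => [|k kr xk1]; first by rewrite xr nr_theta.
  have [E _ _] := step_ok kr.
  have -> : n k = - unit_at (s k.+1) + n k.+1 by rewrite E addrC addrK.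
  by rewrite x_step // raddfD; apply: root_space_lie xk1; apply: root_space_f.
have e_root j k : (k <= r)%N -> root_space c (rt (n k + unit_at j)) (lie (ev c j) (x k)).
  move=> kr; rewrite addrC raddfD; apply: root_space_lie (x_root k kr).
  by apply: root_space_e.
have f_root j k : (k <= r)%N -> root_space c (rt (n k - unit_at j)) (lie (fv c j) (x k)).
  move=> kr; rewrite addrC raddfD; apply: root_space_lie (x_root k kr).
  by apply: root_space_f.
have x_up k : (k < r)%N -> lie (ev c (s k.+1)) (x k) = x k.+1.
  move=> kr; have [_ rt1 nr] := step_ok kr.
  rewrite x_step // lie_deriv lie_ef eqxx (x_root _ kr) rt1 scale1r.
  by rewrite (root_space_no_root nr (e_root _ _ kr)) lie0r addr0.
exists x; split=> [j k kr|j k ji kr|k kr|k kr|].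
- case: ifP => [/andP[kr' /eqP ->]|H]; first exact: x_up.
  have [jj hj Ej] := node_of j; rewrite Ej.
  by apply: root_space_no_root (e_root _ _ kr); apply: up_ok; rewrite // -Ej H.
- case: ifP => [/andP[k0 /eqP ->]|H].
    by case: k k0 kr => // k _ kr; rewrite -x_step.
  have [jj hj Ej] := node_of j; rewrite Ej.
  by apply: root_space_no_root (f_root _ _ kr); apply: down_ok; rewrite // -Ej ?H.
- have /and5P[dE d0 di _ _] := ok_k kr; split; first exact: x_root.
  + move=> j; have [jj hj ->] := node_of j; rewrite of_coords_node //.
    by apply: (allP d0); rewrite mem_nth // E6_pos_size //; lia.
  + by move=> E; move: dE; rewrite -ncoords // E /coords !ffunE.
  + move=> E; case/eqP: di; rewrite -ncoords // E.
    by rewrite coords_unit.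
- have /and5P[_ _ _ nr _] := ok_k kr.
  have E : n k + - unit_at (node i) - unit_at (node i) = n k + unit_at (node i) *~ (-2).
    by rewrite -addrA -opprD -mulr2n mulrNz pmulrn.
  apply: (@root_space_no_root (n k - unit_at (node i) - unit_at (node i))).
    by rewrite E coords_ladd // ncoords.
  rewrite addrC raddfD; apply: root_space_lie (f_root _ _ kr).
  exact: root_space_f.
- apply: descend => [|k kr]; first by rewrite xr.
  by apply: contraNneq => xk; rewrite -x_up // xk lie0r.
Qed.
End ChainVectors.
End Chains.

(** The facts on the 27-dimensional module that the construction of a chain relies
    on; [ps] lists the indices of the weight vectors of the chain. *)
Definition chain27_ok (t : seq nat) (i : nat) (ss : seq nat) (ds : seq (seq int))
    (ps : seq nat) : bool :=
  let r := (size ds).-1 in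
  all (fun k => let d := nth [::] ds k in let p := nth 0%N ps k in
    [&& (p < 27)%N, dn27 t i.-1 (dn27 t i.-1 p) == 27%N,
        no_root (ladd d i (-1)) || (dn27 t i.-1 p == 27%N) &
    all (fun j =>
      [&& up27 t j.-1 p == (if (0 < k)%N && (j == nth 0%N ss k)
                            then nth 0%N ps k.-1 else 27%N),
          (j == i) || (dn27 t j.-1 p == (if (k < r)%N && (j == nth 0%N ss k.+1)
                            then nth 0%N ps k.+1 else 27%N)) &
          wt27 t j.-1 p == (j == i)%:Z - lrt j d])
    (iota 1 6)]) (iota 0 (size ds)).

Definition chain_basis := [:: 0; 1; 2; 3; 5]%N.

Lemma chain27_ok2 : chain27_ok relabel_flip 2 chain_nodes2 chain_roots2 chain_basis.
Proof. by vm_compute. Qed.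
Lemma chain27_ok4 : chain27_ok relabel_id 4 chain_nodes4 chain_roots4 chain_basis.
Proof. by vm_compute. Qed.

Section NoKill.
Variables (K : numFieldType) (g : finLieAlgType K) (c : chevalley g).
Hypothesis simple_g : simple_lie g.

Lemma simple_nonzero : exists z : g, z != 0.
Proof. by case: simple_g => -[x [y xy]] _; exists (lie x y). Qed.

Lemma nokill27 t i ss ds ps k : relabel_ok t -> chain_ok i ss ds ->
  chain27_ok t i ss ds ps -> (k < size ds)%N ->
  exists2 y, root_space c (- rt (of_coords (nth [::] ds k))) y &
    forall m, (0 < m)%N -> ~ kills c (node i) m (ut y 1).
Proof.
move=> tok ok ok27 kr; have gn0 := simple_nonzero.
have [z zt z0] := is_weight_theta c gn0.
have [x [x_e x_f x_root fi_fi x0]] := chain_root_vectors ok zt z0.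
have [rho [lrho rho_lie rhoe rhof rhoh]] := rep27 c tok gn0.
have rho_rep : trep rho (fun=> 0).
  split=> // [k' u v|u v|u v]; first by rewrite scaler0 addr0.
    by rewrite /commx mulmx0 mul0mx subrr.
  by rewrite /commx mulmx0 subrr.
pose w k := basis_col K 27 (nth 0%N ps k).
have nodeE j : (0 < j <= 6)%N -> (node j : nat) = j.-1.
  by move=> hj; rewrite /node inordK; lia.
have i16 : (0 < i <= 6)%N by case/and5P: ok => _ _ _ _ /and3P[].
have le_r l : (l <= (size ds).-1)%N -> (l < size ds)%N by move: kr; lia.
have okk l : (l <= (size ds).-1)%N -> let d := nth [::] ds l in let p := nth 0%N ps l in
    [/\ (p < 27)%N, dn27 t i.-1 (dn27 t i.-1 p) = 27%N,
        no_root (ladd d i (-1)) \/ (dn27 t i.-1 p = 27%N) &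
     forall j, (0 < j <= 6)%N ->
      [/\ up27 t j.-1 p = (if (0 < l)%N && (j == nth 0%N ss l)
                            then nth 0%N ps l.-1 else 27%N),
          j <> i -> dn27 t j.-1 p = (if (l < (size ds).-1)%N && (j == nth 0%N ss l.+1)
                            then nth 0%N ps l.+1 else 27%N) &
          wt27 t j.-1 p = (j == i)%:Z - lrt j d]].
  move=> lr; have lin : l \in iota 0 (size ds) by rewrite mem_iota /= le_r.
  have /and4P[p27 /eqP dd H /allP J] := allP ok27 _ lin; split=> //.
    by case/orP: H => [|/eqP]; [left|right].
  move=> j hj; have jin : j \in iota 1 6 by rewrite mem_iota; lia.
  have /and3P[/eqP upE H1 /eqP wE] := J _ jin; split=> // ji.
  by case/orP: H1 => /eqP.
have ssE j l : (0 < j <= 6)%N -> (l < size ds)%N ->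
    (node j == node (nth 0%N ss l)) = (j == nth 0%N ss l).
  move=> hj lr; rewrite node_eq //.
  have /and5P[_ _ _ /allP ssP /and3P[/eqP sz _ _]] := ok.
  by apply/ssP/mem_nth; rewrite sz.
have colE (f : int -> int -> int) j q :
    pmap_mx K 27 (shift27 f t j) *m basis_col K 27 q =
    basis_col K 27 (shift27 f t j q).
  by apply: pmap_mx_col => l hl; rewrite shift27_out.
have col27 : basis_col K 27 27 = 0 by apply: basis_col_out.
have lowE l : (l <= (size ds).-1)%N ->
    rho (fv c (node i)) *m w l = basis_col K 27 (dn27 t i.-1 (nth 0%N ps l)).
  by move=> lr; rewrite rhof nodeE // colE.
have ncoords l : (l <= (size ds).-1)%N ->
    coords (of_coords (nth [::] ds l)) = nth [::] ds l.
  move=> lr; have /and5P[_ _ _ _ /and3P[_ _ /allP/(_ l)]] := ok.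
  rewrite mem_iota /= le_r // => /(_ isT)/and5P[dE _ _ _ _].
  by rewrite of_coordsK ?E6_pos_size.
apply: (@chain_nokill K g c (node i) 27 (size ds).-1 rho (fun l => node (nth 0%N ss l))
  (fun l => of_coords (nth [::] ds l)) x w rho_rep) => //.
- move=> j l lr; have [jj hj ->] := node_of j.
  have [_ _ _ /(_ _ hj)[upE _ _]] := okk l lr.
  rewrite rhoe nodeE // colE -/up27 upE ssE ?le_r //.
  by case: ifP.
- move=> j l ji lr; have [jj hj Ej] := node_of j.
  have [_ _ _ /(_ _ hj)[_ dnE _]] := okk l lr.
  rewrite Ej rhof nodeE // colE -/dn27 dnE => [|E]; last by rewrite Ej E eqxx in ji.
  case: ltnP => [lr'|_] //=; rewrite ssE //; last by apply: le_r.
  by case: ifP.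
- move=> j l lr; have [jj hj ->] := node_of j.
  have [p27 _ _ /(_ _ hj)[_ _ wE]] := okk l lr.
  by rewrite rhoh // nodeE // wE node_eq // rt_coords // ncoords.
- move=> l lr; have [_ dd H _] := okk l lr; split; first exact: fi_fi.
    by rewrite lowE // rhof nodeE // colE -/dn27 dd.
  case: H => [nr|d27]; last by right; rewrite lowE // d27.
  left; apply: (@root_space_no_root _ _ c
    (of_coords (nth [::] ds l) - unit_at (node i))).
    by rewrite -mulrN1z coords_ladd // ncoords.
  rewrite addrC raddfD; have [xl _ _ _] := x_root l lr.
  by apply: root_space_lie xl; apply: root_space_f.
- by move: kr; lia.
- move=> l lr /(congr1 coords); rewrite !ncoords //; last by move: kr; lia.
  have /and5P[_ uds _ _ _] := ok.
  by move/eqP; rewrite nth_uniq // ?le_r // => /eqP.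
- by apply: x0; move: kr; lia.
- have [|p27 _ _ _] := okk k; first by move: kr; lia.
  apply/eqP => /colP/(_ (Ordinal p27)); rewrite !mxE /= eqxx => /eqP.
  by rewrite oner_eq0.
Qed.

(** For node 6 the chain is reduced to the highest root, with the trivial module in
    place of the 27-dimensional one. *)
Lemma nokill6 : exists2 y, root_space c (- rt theta) y &
    forall m, (0 < m)%N -> ~ kills c (node 6) m (ut y 1).
Proof.
have gn0 := simple_nonzero; have [z zt z0] := is_weight_theta c gn0.
have [x [x_e x_f x_root fi_fi x0]] := chain_root_vectors chain_ok6 zt z0.
have rho_rep : trep (fun _ : g => 0 : 'M[K]_1) (fun=> 0).
  split=> // [k u v|k u v|u v|u v|u v];
    by rewrite ?scaler0 ?addr0 // /commx mulmx0 subrr.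
have thetaE : of_coords [:: 1; 2; 3; 2; 1; 2] = theta.
  by apply: coords_inj; rewrite of_coordsK // coords_theta.
have H := @chain_nokill K g c (node 6) 1 0 _ (fun l => node (nth 0%N chain_nodes6 l))
  (fun l => of_coords (nth [::] chain_roots6 l)) x (fun=> 1%:M) rho_rep x_e _ x_f _ x_root
  _ _ 0 simple_g gn0 isT.
rewrite -thetaE; apply: H.
- by move=> j [|k] // _; rewrite mul0mx.
- by move=> j [|k] // _ _; rewrite mul0mx.
- move=> j [|k] // _; rewrite mul0mx /= thetaE; have [jj hj ->] := node_of j.
  rewrite rt_coords // node_eq // coords_theta.
  by case: jj hj => [|[|[|[|[|[|[|jj]]]]]]] // _; rewrite ?scale0r.
- move=> k kr; split; [exact: fi_fi|by rewrite mul0mx|by right; rewrite mul0mx].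
- by case.
- exact: x0.
- by rewrite -scalemx1 scale1r oner_eq0.
Qed.

End NoKill.

(** * The sets Psi *)

Lemma E6_pos_coef2_check : all (fun r =>
  [&& r`_0 <= 1, r`_4 <= 1, r`_1 <= 2, r`_3 <= 2, r`_5 <= 2,
      (r`_1 < 2) || (r \in chain_roots2), (r`_3 < 2) || (r \in chain_roots4) &
      (r`_5 < 2) || (r == [:: 1; 2; 3; 2; 1; 2])]) E6_pos.
Proof. by vm_compute. Qed.

Section Final.
Variables (K : numFieldType) (g : finLieAlgType K) (c : chevalley g).
Hypothesis simple_g : simple_lie g.

Definition pos_weight n := [/\ is_weight c n, nonneg n & n <> 0].

Lemma pos_rootP al : pos_root c al <-> exists2 n, al = rt n & pos_weight n.
Proof.
split=> [[al0 [n En] [x xal x0]]|[n -> [[x xn x0] n0 nn0]]].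
  rewrite rt_sum in En; exists [ffun i => (n i)%:Z] => //; split.
  - by exists x => //; rewrite -En.
  - by move=> i; rewrite ffunE; lia.
  - by move=> E; move: al0; rewrite En E raddf0 eqxx.
split; last by exists x.
- by apply/eqP => E; apply: nn0; apply: rt_inj; rewrite E raddf0.
- exists (fun i => `|n i|%N); rewrite rt_sum; congr rt; apply/ffunP => i.
  by rewrite ffunE gez0_abs.
Qed.

Lemma pos_weight_coefs n : pos_weight n ->
  [/\ n (node 1) <= 1, n (node 5) <= 1 &
   [/\ n (node 2) <= 2, n (node 4) <= 2 & n (node 6) <= 2]] /\
  [/\ 2 <= n (node 2) -> coords n \in chain_roots2,
      2 <= n (node 4) -> coords n \in chain_roots4 &
      2 <= n (node 6) -> n = theta].
Proof.
case=> nW n0 nn0; have := allP E6_pos_coef2_check _ (is_weight_list nW n0 nn0).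
rewrite -![(coords n)`_0]/(n (node 1)) -![(coords n)`_1]/(n (node 2)).
rewrite -![(coords n)`_3]/(n (node 4)) -![(coords n)`_4]/(n (node 5)).
rewrite -![(coords n)`_5]/(n (node 6)).
case/and5P=> -> -> -> -> /and4P[-> H2 H4 H6]; do ![split=> //].
- by rewrite leNgt; case/orP: H2 => [->|].
- by rewrite leNgt; case/orP: H4 => [->|].
- rewrite leNgt; case/orP: H6 => [->//|/eqP E _].
  by apply: coords_inj; rewrite coords_theta.
Qed.

Definition coef2_node (i : 'I_6) := [|| i == node 2, i == node 4 | i == node 6].

Lemma coef2_nokill i n : coef2_node i -> pos_weight n -> 2 <= n i ->
  exists2 y, root_space c (- rt n) y & forall m, (0 < m)%N -> ~ kills c i m (ut y 1).
Proof.
move=> ci nW n2; have [_ [n2P n4P n6P]] := pos_weight_coefs nW.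
have chainE ds : coords n \in ds ->
    exists2 k, (k < size ds)%N & n = of_coords (nth [::] ds k).
  move=> nds; exists (index (coords n) ds); first by rewrite index_mem.
  by rewrite nth_index ?coordsK.
case/or3P: ci n2 => /eqP -> n2.
- have [k kr ->] := chainE _ (n2P n2).
  exact: (nokill27 c simple_g relabel_flip_ok chain_ok2 chain27_ok2 kr).
- have [k kr ->] := chainE _ (n4P n2).
  exact: (nokill27 c simple_g relabel_id_ok chain_ok4 chain27_ok4 kr).
- by rewrite (n6P n2); apply: nokill6.
Qed.

Lemma coef_le2 i n : coef2_node i -> pos_weight n -> n i <= 2.
Proof.
move=> ci nW; have [[_ _ [h2 h4 h6]] _] := pos_weight_coefs nW.
by case/or3P: ci => /eqP ->.
Qed.

Lemma pos_weight_theta : pos_weight theta.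
Proof.
split; first exact/is_weight_theta/simple_nonzero.
- apply: nodeP; by rewrite ffunE /node inordK.
- by move=> /ffunP/(_ (node 1)); rewrite !ffunE /node inordK.
Qed.

Lemma theta_coef2 i : coef2_node i -> theta i = 2.
Proof. by case/or3P=> /eqP ->; rewrite ffunE /node inordK. Qed.

(** The coefficient at [i] is at most 2, and 2 for the highest root. *)
Lemma Psi_downE i : coef2_node i ->
  Psi_down c (unit_at i) =
  [set al | exists n, [/\ al = rt n, pos_weight n & 2 <= n i]]%classic.
Proof.
move=> ci; have [k k0 kP] := wform_rt c (simple_nonzero simple_g).
have wE n : wform c (rt n) (unit_at i) = k * (n i)%:~R.
  rewrite kP; congr (_ * _%:~R); under eq_bigr do rewrite mulrC ffunE.
  exact: sum_mul_unit.
have leE m n : (wform c (rt m) (unit_at i) <= wform c (rt n) (unit_at i)) = (m i <= n i).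
  by rewrite !wE ler_pM2l // ler_int.
apply/seteqP; split=> al.
- case=> /pos_rootP[n -> nW] max; exists n; split=> //.
  rewrite -(theta_coef2 ci) -leE; apply: max; apply/pos_rootP.
  by exists theta => //; apply: pos_weight_theta.
- case=> n [-> nW n2]; split; first by apply/pos_rootP; exists n.
  move=> _ /pos_rootP[m -> mW]; rewrite leE; apply: le_trans n2.
  exact: coef_le2.
Qed.

(** Nodes 1 and 5 do not contribute, their coefficients being at most 1. *)
Lemma Psi_upE (lam : weight) : lam (node 3) = 0 ->
  Psi_up c lam = [set al | exists n, [/\ al = rt n, pos_weight n &
    exists i, [/\ coef2_node i, lam i != 0 & 2 <= n i]]]%classic.
Proof.
move=> lam3; apply/seteqP; split=> al.
- case=> /pos_rootP[n -> nW] nR; exists n; split=> //.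
  have [//|H] := pselect (exists i, [/\ coef2_node i, lam i != 0 & 2 <= n i]).
  case: nR => i _; split; first by apply/pos_rootP; exists n.
  have [nWn n0 nn0] := nW; move=> x xn.
  apply: (kills_root_vector n0 nn0 _ xn).
  have [li|li] := eqVneq (lam i) 0; first by rewrite li.
  apply/orP; right.
  have [[n1 n5 _] _] := pos_weight_coefs nW.
  have [ci|] := boolP (coef2_node i).
    by rewrite leNgt; apply/negP => n2; apply: H; exists i.
  move: li; rewrite /coef2_node; have [j hj ->] := node_of i; rewrite !node_eq //.
  by case: j hj => [|[|[|[|[|[|[|j]]]]]]] //; rewrite lam3 eqxx.
- case=> n [-> nW [i [ci li n2]]]; split; first by apply/pos_rootP; exists n.
  move=> /(_ i Logic.I) [_ H].
  have [y yn yP] := coef2_nokill ci nW n2.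
  by apply: (yP `|lam i|%N); [rewrite absz_gt0|apply: H].
Qed.
End Final.

Local Open Scope classical_set_scope.
Theorem lemma3p19 (R : realType) (g : finLieAlgType R[i])
    (simple_g : simple_lie g) (c : chevalley g)
    (lam : weight) (lam_dom : dominant lam)
    (lam3 : lam (node 3) = 0)
    (lam24 : ~ ([set node 2; node 4] `<=` supp lam)) :
  Psi_up c lam = set0 \/ exists nu : weight, Psi_up c lam = Psi_down c nu.
Proof.
have i2 : coef2_node (node 2) by rewrite /coef2_node eqxx.
have i4 : coef2_node (node 4) by rewrite /coef2_node eqxx orbT.
have i6 : coef2_node (node 6) by rewrite /coef2_node eqxx !orbT.
have {}lam24 : lam (node 2) = 0 \/ lam (node 4) = 0.
  have [->|l2] := eqVneq (lam (node 2)) 0; first by left.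
  have [->|l4] := eqVneq (lam (node 4)) 0; first by right.
  by case: lam24 => _ [->|->].
(* node 6 adds nothing to another node of the support: the highest root is the
     only one with coefficient 2 there *)
have reduce i : coef2_node i -> lam i != 0 ->
    (forall j, coef2_node j -> lam j != 0 -> j = i \/ j = node 6) ->
    exists nu, Psi_up c lam = Psi_down c nu.
  move=> ci li jP; exists (unit_at i); rewrite Psi_upE // Psi_downE //.
  apply/seteqP; split=> al [n [-> nW]] => [[j [cj lj n2]]|n2].
    exists n; split=> //; case: (jP j cj lj) => E; rewrite E in n2; first by [].
    have [_ [_ _ ->//]] := pos_weight_coefs nW.
    by rewrite theta_coef2.
  by exists n; split=> //; exists i.
have [l2|l2] := eqVneq (lam (node 2)) 0; last first.
  right; apply: (reduce (node 2)) => // j /or3P[]/eqP ->; [by left| |by right].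
  by case: lam24 => E; rewrite E ?eqxx // in l2 *.
have [l4|l4] := eqVneq (lam (node 4)) 0; last first.
  right; apply: (reduce (node 4)) => // j /or3P[]/eqP ->; [|by left|by right].
  by rewrite l2 eqxx.
have [l6|l6] := eqVneq (lam (node 6)) 0; last first.
  right; apply: (reduce (node 6)) => // j /or3P[]/eqP ->; last by left.
    by rewrite l2 eqxx.
  by rewrite l4 eqxx.
left; rewrite Psi_upE //; apply/seteqP; split=> // al [n [_ _ [i [ci li _]]]].
by case/or3P: ci li => /eqP ->; rewrite ?l2 ?l4 ?l6 eqxx.
Qed.
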